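(* Let $c,a:\mathbb{R}\to\mathbb{R}$ be smooth functions such that $c^{(l)}$ and $a^{(l)}$ are bounded on $\mathbb{R}$ for $l=1,2,3$, and $|c'(z)|\ge m_0$, $|a(z)|\ge m_0$ for all $z\in\mathbb{R}$, for some constant $m_0>0$. Let $\varphi_1\in\mathbb{R}$ be a constant with $c(\varphi_1)=0$, and let $\varphi_2,\psi_1,\psi_2:\mathbb{R}\to\mathbb{R}$ be smooth functions such that $\varphi_2^{(j)}$ ($j=1,\dots,4$) and $\psi_1^{(k)},\psi_2^{(k)}$ ($k=0,1,2,3$) are bounded on $\mathbb{R}$, and $|\psi_1(x)|\ge \psi_0$ for all $x\in\mathbb{R}$, for some constant $\psi_0>0$. Then there exist constants $\lambda_0>0$ and $\delta>0$ such that for every $\lambda\in\mathbb{R}$ with $|\lambda|\le\lambda_0$, the degenerate Cauchy problem consisting of the system \[ \begin{aligned} R_{1t}-cR_{1x}&=\tfrac{c'(R_1+S_1)}{4}\tfrac{R_1-S_1}{c}+\lambda aa'\tfrac{R_2-S_2}{c}-\tfrac{a^2c'}{4}\tfrac{(R_2-S_2)^2}{c}+aa'R_2S_2,\\ S_{1t}+cS_{1x}&=\tfrac{c'(R_1+S_1)}{4}\tfrac{S_1-R_1}{c}+\lambda aa'\tfrac{R_2-S_2}{c}-\tfrac{a^2c'}{4}\tfrac{(R_2-S_2)^2}{c}+aa'R_2S_2,\\ R_{2t}-cR_{2x}&=\tfrac{c'R_1}{2}\tfrac{R_2-S_2}{c}-\tfrac{\lambda a'}{a}\tfrac{R_1-S_1}{c}-\tfrac{a'}{a}(R_1S_2+S_1R_2),\\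 S_{2t}+cS_{2x}&=\tfrac{c'S_1}{2}\tfrac{S_2-R_2}{c}-\tfrac{\lambda a'}{a}\tfrac{R_1-S_1}{c}-\tfrac{a'}{a}(R_1S_2+S_1R_2),\\ u_t&=\tfrac{R_1+S_1}{2},\qquad v_t=\tfrac{R_2+S_2}{2}, \end{aligned} \] (where $c,c',a,a'$ are evaluated at $u$) together with the initial conditions, for all $x\in\mathbb{R}$, \[ R_1(0,x)=S_1(0,x)=\psi_1(x),\quad R_2(0,x)=S_2(0,x)=\psi_2(x), \] \[ R_{1t}(0,x)=S_{1t}(0,x)=f_{11}(x),\quad R_{2t}(0,x)=f_{21}(x),\quad S_{2t}(0,x)=f_{22}(x), \] \[ u(0,x)=\varphi_1,\ u_t(0,x)=\psi_1(x),\ v(0,x)=\varphi_2(x),\ v_t(0,x)=\psi_2(x), \] has a classical solution $(R_1,S_1,R_2,S_2,u,v)$ on $[0,\delta]\times\mathbb{R}$.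
   Context: Here $f_{11}(x)=a(\varphi_1)a'(\varphi_1)\psi_2^2(x)+2\lambda a(\varphi_1)a'(\varphi_1)\varphi_2'(x)$, $f_{21}(x)=c'(\varphi_1)\psi_1(x)\varphi_2'(x)-\frac{2a'(\varphi_1)}{a(\varphi_1)}\psi_1(x)\psi_2(x)$, $f_{22}(x)=-c'(\varphi_1)\psi_1(x)\varphi_2'(x)-\frac{2a'(\varphi_1)}{a(\varphi_1)}\psi_1(x)\psi_2(x)$. The system is obtained from the variational wave system below by setting $R_1=u_t+c(u)u_x$, $S_1=u_t-c(u)u_x$, $R_2=v_t+c(u)v_x$, $S_2=v_t-c(u)v_x$. Since $c(u(0,x))=c(\varphi_1)=0$, the system is parabolically degenerate on the initial line $t=0$ (its coefficients contain $1/c$). A classical solution means continuously differentiable functions on $[0,\delta]\times\mathbb{R}$ satisfying the equations (where $c(u)\ne0$, i.e. for $t>0$) and the initial conditions. *)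

(* Defs.v *)
From Stdlib Require Import Reals Lra.
Open Scope R_scope.

(* D is the sequence of all derivatives of f: D 0 = f, D (n+1) = (D n)'.
   Existence of such D is exactly "f is C^infinity (smooth)"; D n is f^(n). *)
Definition smooth_with (f : R -> R) (D : nat -> R -> R) : Prop :=
  (forall x, D 0%nat x = f x) /\
  (forall (n : nat) (x : R), derivable_pt_lim (D n) x (D (S n) x)).

Definition bounded_fun (f : R -> R) : Prop :=
  exists M : R, forall x : R, Rabs (f x) <= M.

Definition cont_strip (delta : R) (G : R -> R -> R) : Prop :=
  forall t x, 0 <= t <= delta ->
  forall eps, 0 < eps -> exists d, 0 < d /\
    forall t' x', 0 <= t' <= delta -> Rabs (t' - t) < d -> Rabs (x' - x) < d ->
      Rabs (G t' x' - G t x) < eps.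

(* Ft is the partial t-derivative of F on the strip (one-sided at t=0, t=delta). *)
Definition pderiv_t (delta : R) (F Ft : R -> R -> R) : Prop :=
  forall t x, 0 <= t <= delta ->
  forall eps, 0 < eps -> exists d, 0 < d /\
    forall h, h <> 0 -> Rabs h < d -> 0 <= t + h <= delta ->
      Rabs ((F (t + h) x - F t x) / h - Ft t x) < eps.

Definition pderiv_x (delta : R) (F Fx : R -> R -> R) : Prop :=
  forall t x, 0 <= t <= delta -> derivable_pt_lim (fun y => F t y) x (Fx t x).

Definition C1_strip (delta : R) (F Ft Fx : R -> R -> R) : Prop :=
  cont_strip delta F /\ pderiv_t delta F Ft /\ pderiv_x delta F Fx /\
  cont_strip delta Ft /\ cont_strip delta Fx.

(* The functions f11, f21, f22 of the paper; Dc, Da, Dphi2 are the derivative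
   sequences of c, a, phi2. *)
Definition f11 (Da Dphi2 : nat -> R -> R) (phi1 lambda : R) (psi2 : R -> R) (x : R) : R :=
  Da 0%nat phi1 * Da 1%nat phi1 * (psi2 x) ^ 2
  + 2 * lambda * Da 0%nat phi1 * Da 1%nat phi1 * Dphi2 1%nat x.

Definition f21 (Dc Da Dphi2 : nat -> R -> R) (phi1 : R) (psi1 psi2 : R -> R) (x : R) : R :=
  Dc 1%nat phi1 * psi1 x * Dphi2 1%nat x
  - 2 * Da 1%nat phi1 / Da 0%nat phi1 * psi1 x * psi2 x.

Definition f22 (Dc Da Dphi2 : nat -> R -> R) (phi1 : R) (psi1 psi2 : R -> R) (x : R) : R :=
  - (Dc 1%nat phi1 * psi1 x * Dphi2 1%nat x)
  - 2 * Da 1%nat phi1 / Da 0%nat phi1 * psi1 x * psi2 x.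

Definition classical_solution (c a : R -> R) (Dc Da Dphi2 : nat -> R -> R)
  (phi1 : R) (phi2 psi1 psi2 : R -> R) (lambda delta : R) : Prop :=
  exists (R1 S1 R2 S2 u v R1t R1x S1t S1x R2t R2x S2t S2x ut ux vt vx : R -> R -> R),
    C1_strip delta R1 R1t R1x /\ C1_strip delta S1 S1t S1x /\
    C1_strip delta R2 R2t R2x /\ C1_strip delta S2 S2t S2x /\
    C1_strip delta u ut ux /\ C1_strip delta v vt vx /\
    (forall t x, 0 < t <= delta ->
      let C := c (u t x) in let C' := Dc 1%nat (u t x) in
      let A := a (u t x) in let A' := Da 1%nat (u t x) in
      let r1 := R1 t x in let s1 := S1 t x in
      let r2 := R2 t x in let s2 := S2 t x in
      R1t t x - C * R1x t x =
        C' * (r1 + s1) / 4 * ((r1 - s1) / C) + lambda * A * A' * ((r2 - s2) / C)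
        - A ^ 2 * C' / 4 * ((r2 - s2) ^ 2 / C) + A * A' * r2 * s2 /\
      S1t t x + C * S1x t x =
        C' * (r1 + s1) / 4 * ((s1 - r1) / C) + lambda * A * A' * ((r2 - s2) / C)
        - A ^ 2 * C' / 4 * ((r2 - s2) ^ 2 / C) + A * A' * r2 * s2 /\
      R2t t x - C * R2x t x =
        C' * r1 / 2 * ((r2 - s2) / C) - lambda * A' / A * ((r1 - s1) / C)
        - A' / A * (r1 * s2 + s1 * r2) /\
      S2t t x + C * S2x t x =
        C' * s1 / 2 * ((s2 - r2) / C) - lambda * A' / A * ((r1 - s1) / C)
        - A' / A * (r1 * s2 + s1 * r2) /\
      ut t x = (r1 + s1) / 2 /\
      vt t x = (r2 + s2) / 2) /\
    (forall x,
      R1 0 x = psi1 x /\ S1 0 x = psi1 x /\ R2 0 x = psi2 x /\ S2 0 x = psi2 x /\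
      R1t 0 x = f11 Da Dphi2 phi1 lambda psi2 x /\
      S1t 0 x = f11 Da Dphi2 phi1 lambda psi2 x /\
      R2t 0 x = f21 Dc Da Dphi2 phi1 psi1 psi2 x /\
      S2t 0 x = f22 Dc Da Dphi2 phi1 psi1 psi2 x /\
      u 0 x = phi1 /\ ut 0 x = psi1 x /\ v 0 x = phi2 x /\ vt 0 x = psi2 x).

(* Main.v *)
Require Import Defs.
From Stdlib Require Import Reals RList Lra Lia ZArith Classical.
From Coquelicot Require Import Rcomplements Rbar Hierarchy Continuity Derive Lim_seq.
From mathcomp Require ssrnat classical_sets filter.
Open Scope R_scope.

(** Subtract from R_i, S_i their prescribed first-order Taylor polynomials in t. Since c(u) = c'(phi1) psi1 t + O(t^2),
    the ratio t c'(u) R_1 / c(u) is 1 + O(t), so along characteristics the remainder rho of R_i obeys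
    rho' = (1 + O(t)) (rho - sigma) / (2 t) + O(lambda / t) rest + O(t), where sigma is the remainder of S_i and rest
    that of the other pair. In sup norm, rho' <= theta rho / t + K t with theta close to 1 < 2, which preserves a
    bound rho <= M t^2. The expansions hold together with two x-derivatives, that is, for second-order jets, whose
    norm is submultiplicative; hence so does the bound.

    Solutions are limits of the semi-Lagrangian scheme R^{k+1}(x) = R^k (x + h c(u^k(x))) + h Phi^k(x), whose
    iterates are compositions of twice differentiable functions and satisfy the bounds uniformly in h. Iterates and
    x-derivatives are uniformly Lipschitz, so they converge pointwise along a free ultrafilter on the steps
    h = 1 / (n + 1), and the inequalities that express differentiability and the equations pass to the limit. *)

Lemma Rabs_plus_le (x y a b : R) : Rabs x <= a -> Rabs y <= b -> Rabs (x + y) <= a + b.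
Proof. intros Hx Hy. eapply Rle_trans; [apply Rabs_triang|]. lra. Qed.

Lemma Rabs_mult_le (x y a b : R) : Rabs x <= a -> Rabs y <= b -> Rabs (x * y) <= a * b.
Proof. intros Hx Hy. rewrite Rabs_mult. apply Rmult_le_compat; auto using Rabs_pos. Qed.

(** * Second-order jets *)

Record jet := Jet { jval : R; jder1 : R; jder2 : R }.

Lemma jet_ext (a b : jet) : jval a = jval b -> jder1 a = jder1 b -> jder2 a = jder2 b -> a = b.
Proof. destruct a, b; simpl; intros; subst; reflexivity. Qed.

Definition jconst (r : R) : jet := Jet r 0 0.
Definition jvar (x : R) : jet := Jet x 1 0.
Definition jadd (a b : jet) : jet := Jet (jval a + jval b) (jder1 a + jder1 b) (jder2 a + jder2 b).
Definition jopp (a : jet) : jet := Jet (- jval a) (- jder1 a) (- jder2 a).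
Definition jsub (a b : jet) : jet := jadd a (jopp b).
Definition jmul (a b : jet) : jet :=
  Jet (jval a * jval b) (jder1 a * jval b + jval a * jder1 b)
      (jder2 a * jval b + 2 * (jder1 a * jder1 b) + jval a * jder2 b).
Definition jcomp (F : R -> jet) (a : jet) : jet :=
  let G := F (jval a) in
  Jet (jval G) (jder1 G * jder1 a) (jder2 G * (jder1 a * jder1 a) + jder1 G * jder2 a).
Definition jinv : jet -> jet :=
  jcomp (fun r => Jet (/ r) (- (/ r * / r)) (2 * (/ r * / r * / r))).

Declare Scope jet_scope.
Delimit Scope jet_scope with J.
Bind Scope jet_scope with jet.
Infix "+" := jadd : jet_scope.
Infix "*" := jmul : jet_scope.
Infix "-" := jsub : jet_scope.
Notation "- a" := (jopp a) : jet_scope.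
Notation "/ a" := (jinv a) : jet_scope.
Notation "0" := (jconst 0) : jet_scope.
Notation "1" := (jconst 1) : jet_scope.

Lemma jet_ring_theory : ring_theory 0%J 1%J jadd jmul jsub jopp eq.
Proof. constructor; intros; try reflexivity; apply jet_ext; simpl; ring. Qed.
Add Ring jet_ring : jet_ring_theory.

Lemma jconst_mul (r s : R) : jconst (r * s) = (jconst r * jconst s)%J.
Proof. apply jet_ext; simpl; ring. Qed.

Lemma jconst_add (r s : R) : jconst (r + s) = (jconst r + jconst s)%J.
Proof. apply jet_ext; simpl; ring. Qed.

Lemma jmul_inv (a : jet) : jval a <> 0 -> (a * / a = 1)%J.
Proof. intros Ha. apply jet_ext; simpl; field; exact Ha. Qed.

Lemma jcomp_add (F G : R -> jet) (a : jet) : jcomp (fun y => F y + G y)%J a = (jcomp F a + jcomp G a)%J.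
Proof. apply jet_ext; simpl; ring. Qed.

Lemma jcomp_mul (F G : R -> jet) (a : jet) : jcomp (fun y => F y * G y)%J a = (jcomp F a * jcomp G a)%J.
Proof. apply jet_ext; simpl; ring. Qed.

Lemma jcomp_const (r : R) (a : jet) : jcomp (fun _ => jconst r) a = jconst r.
Proof. apply jet_ext; simpl; ring. Qed.

Lemma jcomp_var (F : R -> jet) (x : R) : jcomp F (jvar x) = F x.
Proof. apply jet_ext; simpl; ring. Qed.

Definition jnorm (a : jet) : R := Rabs (jval a) + Rabs (jder1 a) + Rabs (jder2 a) / 2.

Lemma jnorm_ge0 (a : jet) : 0 <= jnorm a.
Proof.
  unfold jnorm. pose proof (Rabs_pos (jval a)). pose proof (Rabs_pos (jder1 a)).
  pose proof (Rabs_pos (jder2 a)). lra.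
Qed.

Lemma Rabs_jval_le (a : jet) : Rabs (jval a) <= jnorm a.
Proof. unfold jnorm. pose proof (Rabs_pos (jder1 a)). pose proof (Rabs_pos (jder2 a)). lra. Qed.

Lemma Rabs_jder1_le (a : jet) : Rabs (jder1 a) <= jnorm a.
Proof. unfold jnorm. pose proof (Rabs_pos (jval a)). pose proof (Rabs_pos (jder2 a)). lra. Qed.

Lemma Rabs_jder2_le (a : jet) : Rabs (jder2 a) <= 2 * jnorm a.
Proof. unfold jnorm. pose proof (Rabs_pos (jval a)). pose proof (Rabs_pos (jder1 a)). lra. Qed.

Lemma jnorm_const (r : R) : jnorm (jconst r) = Rabs r.
Proof. unfold jnorm; simpl. rewrite Rabs_R0. lra. Qed.

Lemma jnorm_0 : jnorm 0 = 0.
Proof. rewrite jnorm_const. apply Rabs_R0. Qed.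

Lemma jnorm_add (a b : jet) : jnorm (a + b) <= jnorm a + jnorm b.
Proof.
  unfold jnorm; simpl. pose proof (Rabs_triang (jval a) (jval b)).
  pose proof (Rabs_triang (jder1 a) (jder1 b)). pose proof (Rabs_triang (jder2 a) (jder2 b)). lra.
Qed.

Lemma jnorm_add_le (a b : jet) (r s : R) : jnorm a <= r -> jnorm b <= s -> jnorm (a + b) <= r + s.
Proof. intros Ha Hb. pose proof (jnorm_add a b). lra. Qed.

Lemma jnorm_opp (a : jet) : jnorm (- a) = jnorm a.
Proof. unfold jnorm; simpl. rewrite !Rabs_Ropp. reflexivity. Qed.

Lemma jnorm_sub_le (a b : jet) (r s : R) : jnorm a <= r -> jnorm b <= s -> jnorm (a - b) <= r + s.
Proof. intros Ha Hb. apply jnorm_add_le; [exact Ha|]. rewrite jnorm_opp. exact Hb. Qed.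

Lemma jnorm_scale (r : R) (a : jet) : jnorm (jconst r * a) = Rabs r * jnorm a.
Proof.
  unfold jnorm; simpl.
  replace (0 * jval a + r * jder1 a) with (r * jder1 a) by ring.
  replace (0 * jval a + 2 * (0 * jder1 a) + r * jder2 a) with (r * jder2 a) by ring.
  rewrite !Rabs_mult. field.
Qed.

Lemma jnorm_scale_le (r s : R) (a : jet) : 0 <= r -> jnorm a <= s -> jnorm (jconst r * a) <= r * s.
Proof. intros Hr Ha. rewrite jnorm_scale, Rabs_pos_eq by exact Hr. apply Rmult_le_compat_l; assumption. Qed.

Lemma jnorm_mul (a b : jet) : jnorm (a * b) <= jnorm a * jnorm b.
Proof.
  unfold jnorm; simpl.
  pose proof (Rabs_triang (jder1 a * jval b) (jval a * jder1 b)).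
  pose proof (Rabs_triang (jder2 a * jval b + 2 * (jder1 a * jder1 b)) (jval a * jder2 b)).
  pose proof (Rabs_triang (jder2 a * jval b) (2 * (jder1 a * jder1 b))) as Htriang.
  rewrite !Rabs_mult in *. rewrite (Rabs_pos_eq 2) in Htriang by lra.
  assert (Hpos := fun x y => Rmult_le_pos _ _ (Rabs_pos x) (Rabs_pos y)).
  pose proof (Hpos (jder1 a) (jder2 b)). pose proof (Hpos (jder2 a) (jder1 b)).
  pose proof (Hpos (jder2 a) (jder2 b)).
  lra.
Qed.

Lemma jnorm_mul_le (a b : jet) (r s : R) : jnorm a <= r -> jnorm b <= s -> jnorm (a * b) <= r * s.
Proof.
  intros Ha Hb. eapply Rle_trans; [apply jnorm_mul|]. apply Rmult_le_compat; auto using jnorm_ge0.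
Qed.

Lemma jnorm_comp_le (F : R -> jet) (a : jet) (b0 b1 b2 N : R) :
  Rabs (jval (F (jval a))) <= b0 -> Rabs (jder1 (F (jval a))) <= b1 -> Rabs (jder2 (F (jval a))) <= b2 ->
  Rabs (jder1 a) + Rabs (jder2 a) / 2 <= N ->
  jnorm (jcomp F a) <= b0 + b1 * N + b2 / 2 * N ^ 2.
Proof.
  intros Hval Hder1 Hder2 HN. unfold jnorm; simpl.
  assert (Ha : Rabs (jder1 a) <= N) by (pose proof (Rabs_pos (jder2 a)); lra).
  pose proof (Rabs_mult_le _ _ _ _ Hder1 (Rle_refl (Rabs (jder1 a)))).
  pose proof (Rabs_plus_le _ _ _ _ (Rabs_mult_le _ _ _ _ Hder2 (Rabs_mult_le _ _ _ _ Ha Ha))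
    (Rabs_mult_le _ _ _ _ Hder1 (Rle_refl (Rabs (jder2 a))))).
  assert (b1 * (Rabs (jder1 a) + Rabs (jder2 a) / 2) <= b1 * N).
  { apply Rmult_le_compat_l; [exact (Rle_trans _ _ _ (Rabs_pos _) Hder1)|exact HN]. }
  lra.
Qed.

Lemma jnorm_inv_le (a : jet) (m N : R) :
  0 < m -> m <= Rabs (jval a) -> jnorm a <= N ->
  jnorm (/ a) <= / m + / m * / m * N + / m * / m * / m * N ^ 2.
Proof.
  intros Hm Ha HN.
  assert (Hinv : Rabs (/ jval a) <= / m) by (rewrite Rabs_inv; apply Rinv_le_contravar; assumption).
  assert (Hinv2 := Rabs_mult_le _ _ _ _ Hinv Hinv). assert (Hinv3 := Rabs_mult_le _ _ _ _ Hinv2 Hinv).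
  replace (/ m * / m * / m * N ^ 2) with (2 * (/ m * / m * / m) / 2 * N ^ 2) by (field; lra).
  apply jnorm_comp_le; simpl; [exact Hinv|rewrite Rabs_Ropp; exact Hinv2| |].
  - apply Rabs_mult_le; [rewrite Rabs_pos_eq; lra|exact Hinv3].
  - unfold jnorm in HN. pose proof (Rabs_pos (jval a)). lra.
Qed.

Definition half (a : jet) : jet := (jconst (/ 2) * a)%J.

Lemma half_double (a : jet) : (half a + half a = a)%J.
Proof. apply jet_ext; simpl; field. Qed.

Lemma jnorm_half (a : jet) : jnorm (half a) = jnorm a / 2.
Proof. unfold half. rewrite jnorm_scale, Rabs_pos_eq by lra. field. Qed.

(** * Jets of twice differentiable functions *)

Definition holonomic_at (F : R -> jet) (x : R) : Prop :=
  is_derive (fun y => jval (F y)) x (jder1 (F x)) /\ is_derive (fun y => jder1 (F y)) x (jder2 (F x)).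

Definition holonomic (F : R -> jet) : Prop := forall x, holonomic_at F x.

Lemma holonomic_const (r x : R) : holonomic_at (fun _ => jconst r) x.
Proof. split; apply @is_derive_const. Qed.

Lemma holonomic_var : holonomic jvar.
Proof. intros x. split; [apply @is_derive_id|apply (is_derive_const 1)]. Qed.

Lemma holonomic_add (F G : R -> jet) (x : R) :
  holonomic_at F x -> holonomic_at G x -> holonomic_at (fun y => F y + G y)%J x.
Proof. intros [F1 F2] [G1 G2]. split; apply @is_derive_plus; assumption. Qed.

Lemma holonomic_opp (F : R -> jet) (x : R) : holonomic_at F x -> holonomic_at (fun y => - F y)%J x.
Proof. intros [F1 F2]. split; apply @is_derive_opp; assumption. Qed.

Lemma holonomic_sub (F G : R -> jet) (x : R) :
  holonomic_at F x -> holonomic_at G x -> holonomic_at (fun y => F y - G y)%J x.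
Proof. intros HF HG. apply holonomic_add, holonomic_opp; assumption. Qed.

Lemma holonomic_mul (F G : R -> jet) (x : R) :
  holonomic_at F x -> holonomic_at G x -> holonomic_at (fun y => F y * G y)%J x.
Proof.
  intros [F1 F2] [G1 G2]. split; [apply is_derive_mult; assumption|]. simpl.
  evar_last; [apply @is_derive_plus; apply is_derive_mult; eassumption|].
  unfold plus; simpl. ring.
Qed.

Lemma holonomic_comp (F G : R -> jet) (x : R) :
  holonomic_at F (jval (G x)) -> holonomic_at G x -> holonomic_at (fun y => jcomp F (G y)) x.
Proof.
  intros [F1 F2] [G1 G2].
  split; simpl; (evar_last; [|simpl]).
  - apply (is_derive_comp (fun z => jval (F z))); eassumption.
  - unfold scal; simpl; unfold mult; simpl. ring.
  - apply is_derive_mult; [apply (is_derive_comp (fun z => jder1 (F z)))|]; eassumption.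
  - unfold scal; simpl; unfold mult; simpl. ring.
Qed.

Lemma holonomic_inv (F : R -> jet) (x : R) :
  jval (F x) <> 0 -> holonomic_at F x -> holonomic_at (fun y => / F y)%J x.
Proof.
  intros Hn HF. apply holonomic_comp; [|exact HF].
  assert (Hi : is_derive Rinv (jval (F x)) (- (/ jval (F x) * / jval (F x)))).
  { evar_last; [apply (is_derive_inv (fun y => y)); [apply @is_derive_id|exact Hn]|].
    unfold one; simpl. field. exact Hn. }
  split; [exact Hi|]. simpl.
  evar_last; [apply @is_derive_opp, is_derive_mult; exact Hi|]. unfold opp; simpl. ring.
Qed.

Definition derivative_sequence (D : nat -> R -> R) : Prop :=
  forall (n : nat) (x : R), derivable_pt_lim (D n) x (D (S n) x).

Definition jet_of (D : nat -> R -> R) (n : nat) (x : R) : jet := Jet (D n x) (D (S n) x) (D (S (S n)) x).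

Lemma holonomic_jet_of (D : nat -> R -> R) (n : nat) : derivative_sequence D -> holonomic (jet_of D n).
Proof. intros HD x. split; apply is_derive_Reals, HD. Qed.

Lemma bounded_fun_common_bound (D : nat -> R -> R) (m n : nat) :
  (forall k : nat, (m <= k <= n)%nat -> bounded_fun (D k)) ->
  exists B, 0 <= B /\ forall (k : nat) x, (m <= k <= n)%nat -> Rabs (D k x) <= B.
Proof.
  induction n as [|n IH]; intros HD.
  - destruct (Nat.eq_dec m 0) as [->|Hm].
    + destruct (HD 0%nat ltac:(lia)) as [B HB]. exists B.
      split; [exact (Rle_trans _ _ _ (Rabs_pos _) (HB 0))|].
      intros k x Hk. replace k with 0%nat by lia. apply HB.
    + exists 0. split; [lra|]. intros; lia.
  - destruct IH as (B & B0 & HB); [intros k Hk; apply HD; lia|].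
    destruct (le_dec m (S n)) as [Hm|Hm]; [|exists B; split; [exact B0|intros; lia]].
    destruct (HD (S n) ltac:(lia)) as [C HC].
    exists (Rmax B C). split; [exact (Rle_trans _ _ _ B0 (Rmax_l B C))|]. intros k x Hk.
    destruct (Nat.eq_dec k (S n)) as [->|Hn].
    + exact (Rle_trans _ _ _ (HC x) (Rmax_r B C)).
    + eapply Rle_trans; [apply HB; lia|apply Rmax_l].
Qed.

Lemma increment_bound (f f' : R -> R) (B x d : R) :
  (forall y, is_derive f y (f' y)) -> (forall y, Rabs (f' y) <= B) ->
  Rabs (f (x + d) - f x) <= B * Rabs d.
Proof.
  intros Hf HB. replace (Rabs d) with (Rabs (x + d - x)) by (f_equal; ring).
  apply (bounded_variation f f'). intros y _. split; [apply Hf|apply HB].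
Qed.

Lemma taylor_bound (f f' f'' : R -> R) (B x d : R) :
  (forall y, is_derive f y (f' y)) -> (forall y, is_derive f' y (f'' y)) -> (forall y, Rabs (f'' y) <= B) ->
  Rabs (f (x + d) - f x - d * f' x) <= B * d ^ 2.
Proof.
  intros Hf Hf' HB.
  replace (f (x + d) - f x - d * f' x) with (f (x + d) - f' x * (x + d) - (f x - f' x * x)) by ring.
  rewrite <- pow2_abs. replace (B * Rabs d ^ 2) with (B * Rabs d * Rabs (x + d - x)).
  2: { replace (x + d - x) with d by ring. ring. }
  apply (bounded_variation (fun y => f y - f' x * y) (fun y => f' y - f' x)). intros y Hy. split.
  - apply @is_derive_minus; [apply Hf|]. evar_last; [apply is_derive_scal, @is_derive_id|].
    unfold one; simpl. ring.
  - replace y with (x + (y - x)) by ring.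
    eapply Rle_trans; [apply (increment_bound f' f'' B); assumption|].
    replace (x + d - x) with d in Hy by ring.
    apply Rmult_le_compat_l; [exact (Rle_trans _ _ _ (Rabs_pos _) (HB 0))|exact Hy].
Qed.

Lemma jnorm_comp_sub_value (D : nat -> R -> R) (n : nat) (B z : R) (u : jet) :
  derivative_sequence D -> (forall (k : nat) x, (1 + n <= k <= 2 + n)%nat -> Rabs (D k x) <= B) ->
  let N := jnorm (u - jconst z) in
  jnorm (jcomp (jet_of D n) u - jconst (D n z)) <= B * (N + N ^ 2).
Proof.
  intros HD HB N. set (G := fun y => (jet_of D n y - jconst (D n z))%J).
  replace (jcomp (jet_of D n) u - jconst (D n z))%J with (jcomp G u) by (apply jet_ext; simpl; ring).
  set (d := jval u + - z). set (s := Rabs (jder1 u) + Rabs (jder2 u) / 2).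
  assert (EN : N = Rabs d + s) by (unfold N, jnorm; simpl; rewrite Ropp_0, !Rplus_0_r; unfold d, s; ring).
  assert (HB0 : 0 <= B) by exact (Rle_trans _ _ _ (Rabs_pos _) (HB (S n) z ltac:(lia))).
  pose proof (Rabs_pos d) as Hd.
  assert (Hs : 0 <= s) by (unfold s; pose proof (Rabs_pos (jder1 u)); pose proof (Rabs_pos (jder2 u)); lra).
  eapply Rle_trans; [apply (jnorm_comp_le G u (B * Rabs d) B B); [| | |apply Rle_refl]|].
  - simpl. replace (jval u) with (z + d) by (unfold d; ring).
    apply (increment_bound (D n) (D (S n))); [|intros; apply HB; lia]. intros y. apply is_derive_Reals, HD.
  - simpl. rewrite Ropp_0, Rplus_0_r. apply HB; lia.
  - simpl. rewrite Ropp_0, Rplus_0_r. apply HB; lia.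
  - fold s. rewrite EN. replace (B * Rabs d + B * s + B / 2 * s ^ 2) with (B * (Rabs d + s + s ^ 2 / 2)) by field.
    apply Rmult_le_compat_l; [exact HB0|]. nra.
Qed.

Lemma jnorm_comp_taylor (D : nat -> R -> R) (n : nat) (B z : R) (u : jet) :
  derivative_sequence D -> (forall (k : nat) x, (2 + n <= k <= 3 + n)%nat -> Rabs (D k x) <= B) ->
  let N := jnorm (u - jconst z) in
  jnorm (jcomp (jet_of D n) u - jconst (D n z) - jcomp (jet_of D (S n)) u * (u - jconst z)) <= B * (N ^ 2 + N ^ 3).
Proof.
  intros HD HB N. set (G := fun y => (jet_of D n y - jconst (D n z) - jet_of D (S n) y * (jvar y - jconst z))%J).
  replace (jcomp (jet_of D n) u - jconst (D n z) - jcomp (jet_of D (S n)) u * (u - jconst z))%J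
    with (jcomp G u) by (apply jet_ext; simpl; ring).
  set (d := jval u + - z). set (s := Rabs (jder1 u) + Rabs (jder2 u) / 2).
  assert (EN : N = Rabs d + s) by (unfold N, jnorm; simpl; rewrite Ropp_0, !Rplus_0_r; unfold d, s; ring).
  assert (HB0 : 0 <= B) by exact (Rle_trans _ _ _ (Rabs_pos _) (HB (S (S n)) z ltac:(lia))).
  pose proof (Rabs_pos d) as Hd.
  assert (Hs : 0 <= s) by (unfold s; pose proof (Rabs_pos (jder1 u)); pose proof (Rabs_pos (jder2 u)); lra).
  eapply Rle_trans;
    [apply (jnorm_comp_le G u (B * Rabs d ^ 2) (B * Rabs d) (B * Rabs d + B * 1)); [| | |apply Rle_refl]|].
  - unfold G; simpl jval; fold d. rewrite <- Rabs_Ropp, pow2_abs.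
    replace (- _) with (D n (jval u + - d) - D n (jval u) - - d * D (S n) (jval u))
      by (replace (jval u + - d) with z by (unfold d; ring); ring).
    replace (d ^ 2) with ((- d) ^ 2) by ring.
    apply (taylor_bound (D n) (D (S n)) (D (S (S n)))); [| |intros; apply HB; lia];
      intros y; apply is_derive_Reals, HD.
  - simpl. fold d. replace (_ + _) with (- (D (S (S n)) (jval u) * d)) by ring.
    rewrite Rabs_Ropp. apply Rabs_mult_le; [apply HB; lia|apply Rle_refl].
  - simpl. fold d. replace (_ + _) with (- (D (S (S (S n))) (jval u) * d + D (S (S n)) (jval u) * 1)) by ring.
    rewrite Rabs_Ropp. apply Rabs_plus_le; apply Rabs_mult_le; try (apply HB; lia); rewrite ?Rabs_R1; apply Rle_refl.
  - fold s. rewrite EN. set (e := Rabs d) in *.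
    replace (B * e ^ 2 + B * e * s + (B * e + B * 1) / 2 * s ^ 2)
      with (B * ((e ^ 2 + e * s + s ^ 2 / 2) + e * s * s / 2)) by field.
    apply Rmult_le_compat_l; [exact HB0|]. apply Rplus_le_compat; [nra|].
    assert (Hpos : forall x y w, 0 <= x -> 0 <= y -> 0 <= w -> 0 <= x * y * w)
      by (intros; repeat apply Rmult_le_pos; assumption).
    pose proof (Hpos e s s Hd Hs Hs). pose proof (Hpos e e s Hd Hd Hs). pose proof (Hpos e e e Hd Hd Hd).
    pose proof (Hpos s s s Hs Hs Hs). lra.
Qed.

(* The jet at [x] of [y |-> F (y + b y)], where [b] is the jet at [x] of the displacement. *)
Definition jshift (b : jet) (F : R -> jet) (x : R) : jet := jcomp F (jvar x + b).

Lemma jshift_0 (F : R -> jet) (x : R) : jshift 0 F x = F x.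
Proof. unfold jshift. replace (jvar x + 0)%J with (jvar x) by ring. apply jcomp_var. Qed.

Lemma jnorm_jshift_le (b : jet) (F : R -> jet) (x N : R) :
  (forall y, jnorm (F y) <= N) -> jnorm b <= 1 -> jnorm (jshift b F x) <= N * (1 + 3 * jnorm b).
Proof.
  intros HF Hb. set (G := F (jval (jvar x + b)%J)). set (e := jnorm b) in *.
  assert (He : Rabs (1 + jder1 b) + Rabs (0 + jder2 b) / 2 <= 1 + e).
  { pose proof (Rabs_triang 1 (jder1 b)) as Htriang. rewrite Rabs_R1 in Htriang. rewrite Rplus_0_l.
    unfold e, jnorm. pose proof (Rabs_pos (jval b)). lra. }
  pose proof (jnorm_ge0 b : 0 <= e) as He0.
  eapply Rle_trans; [apply (jnorm_comp_le F _ (Rabs (jval G)) (Rabs (jder1 G)) (Rabs (jder2 G)) _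
    (Rle_refl _) (Rle_refl _) (Rle_refl _) He)|].
  apply Rle_trans with (jnorm G * (1 + 3 * e)); [|apply Rmult_le_compat_r; [lra|apply HF]].
  unfold jnorm. pose proof (Rabs_pos (jval G)). pose proof (Rabs_pos (jder1 G)). pose proof (Rabs_pos (jder2 G)).
  assert (Hsquare : (1 + e) ^ 2 <= 1 + 3 * e) by nra.
  pose proof (Rmult_le_compat_l (Rabs (jder2 G) / 2) _ _ ltac:(lra) Hsquare).
  assert (0 <= Rabs (jval G) * e) by (apply Rmult_le_pos; assumption).
  assert (0 <= Rabs (jder1 G) * e) by (apply Rmult_le_pos; assumption).
  lra.
Qed.

(* A Lipschitz condition on the jets that is stable under products without a third-order Leibniz formula. *)
Definition jshift_lipschitz (F : R -> jet) (L : R) : Prop :=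
  forall (b : jet) (x : R), jnorm b <= 1 -> jnorm (jshift b F x - F x) <= L * jnorm b.

Definition jshift_stable (F : R -> jet) (L : R) : Prop :=
  (forall x, jnorm (F x) <= L) /\ jshift_lipschitz F L.

Lemma jshift_lipschitz_weaken {F : R -> jet} {L M : R} : L <= M -> jshift_lipschitz F L -> jshift_lipschitz F M.
Proof.
  intros HLM HF b x Hb. eapply Rle_trans; [apply HF, Hb|]. apply Rmult_le_compat_r; [apply jnorm_ge0|exact HLM].
Qed.

Lemma jshift_stable_weaken {F : R -> jet} {L M : R} : L <= M -> jshift_stable F L -> jshift_stable F M.
Proof.
  intros HLM [F0 F1]. split; [|exact (jshift_lipschitz_weaken HLM F1)].
  intros x. exact (Rle_trans _ _ _ (F0 x) HLM).
Qed.

Lemma jshift_stable_ge0 {F : R -> jet} {L : R} : jshift_stable F L -> 0 <= L.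
Proof. intros [HF _]. exact (Rle_trans _ _ _ (jnorm_ge0 _) (HF 0)). Qed.

(* Displacements with jet (0, 1, 0) dilate the first two derivatives by 2 and 4. *)
Lemma jshift_lipschitz_derivatives {F : R -> jet} {L : R} (x : R) :
  jshift_lipschitz F L -> Rabs (jder1 (F x)) <= L /\ Rabs (jder2 (F x)) <= L.
Proof.
  intros HF.
  assert (Hnorm : jnorm (Jet 0 1 0) = 1) by (unfold jnorm; simpl; rewrite Rabs_R0, Rabs_R1; field).
  pose proof (HF (Jet 0 1 0) x ltac:(lra)) as Hshift. rewrite Hnorm, Rmult_1_r in Hshift.
  replace (jshift (Jet 0 1 0) F x - F x)%J with (Jet 0 (jder1 (F x)) (3 * jder2 (F x))) in Hshift
    by (unfold jshift, jcomp; simpl; rewrite Rplus_0_r; apply jet_ext; simpl; ring).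
  unfold jnorm in Hshift; simpl in Hshift. rewrite Rabs_R0, Rabs_mult, (Rabs_pos_eq 3) in Hshift by lra.
  pose proof (Rabs_pos (jder1 (F x))). pose proof (Rabs_pos (jder2 (F x))). lra.
Qed.

Lemma jshift_lipschitz_const (r : R) : jshift_lipschitz (fun _ => jconst r) 0.
Proof.
  intros b x _. unfold jshift. rewrite jcomp_const.
  replace (jconst r - jconst r)%J with 0%J by ring. rewrite jnorm_0. lra.
Qed.

Lemma jshift_stable_scale (r : R) {L : R} {F : R -> jet} :
  jshift_stable F L -> jshift_stable (fun x => jconst r * F x)%J (Rabs r * L).
Proof.
  intros [F0 F1]. split.
  - intros x. rewrite jnorm_scale. apply Rmult_le_compat_l; [apply Rabs_pos|apply F0].
  - intros b x Hb. unfold jshift. rewrite jcomp_mul, jcomp_const. fold (jshift b F x).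
    replace (jconst r * jshift b F x - jconst r * F x)%J with (jconst r * (jshift b F x - F x))%J by ring.
    rewrite jnorm_scale, Rmult_assoc. apply Rmult_le_compat_l; [apply Rabs_pos|apply F1, Hb].
Qed.

Lemma jshift_stable_scale_le1 {r L : R} {F : R -> jet} :
  Rabs r <= 1 -> jshift_stable F L -> jshift_stable (fun x => jconst r * F x)%J L.
Proof.
  intros Hr HF. apply (jshift_stable_weaken (L := Rabs r * L)); [|exact (jshift_stable_scale r HF)].
  rewrite <- (Rmult_1_l L) at 2. apply Rmult_le_compat_r; [exact (jshift_stable_ge0 HF)|exact Hr].
Qed.

Lemma jshift_stable_opp {F : R -> jet} {L : R} : jshift_stable F L -> jshift_stable (fun x => - F x)%J L.
Proof.
  intros [F0 F1]. split; [intros x; rewrite jnorm_opp; apply F0|]. intros b x Hb.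
  replace (jshift b (fun y => - F y)%J x - - F x)%J with (- (jshift b F x - F x))%J by (apply jet_ext; simpl; ring).
  rewrite jnorm_opp. apply F1, Hb.
Qed.

Lemma jshift_stable_add {F G : R -> jet} {L M : R} :
  jshift_stable F L -> jshift_stable G M -> jshift_stable (fun x => F x + G x)%J (L + M).
Proof.
  intros [F0 F1] [G0 G1]. split; [intros x; apply jnorm_add_le; auto|]. intros b x Hb.
  unfold jshift. rewrite jcomp_add. fold (jshift b F x) (jshift b G x).
  replace (jshift b F x + jshift b G x - (F x + G x))%J
    with ((jshift b F x - F x) + (jshift b G x - G x))%J by ring.
  rewrite Rmult_plus_distr_r. apply jnorm_add_le; auto.
Qed.

Lemma jshift_stable_mul {F G : R -> jet} {L M : R} :
  jshift_stable F L -> jshift_stable G M -> jshift_stable (fun x => F x * G x)%J (5 * (L * M)).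
Proof.
  intros HF HG. pose proof (jshift_stable_ge0 HF) as HL. pose proof (jshift_stable_ge0 HG) as HM.
  destruct HF as [F0 F1], HG as [G0 G1]. pose proof (Rmult_le_pos _ _ HL HM) as HLM. split.
  - intros x. pose proof (jnorm_mul_le _ _ _ _ (F0 x) (G0 x)). lra.
  - intros b x Hb. unfold jshift. rewrite jcomp_mul. fold (jshift b F x) (jshift b G x).
    replace (jshift b F x * jshift b G x - F x * G x)%J
      with ((jshift b F x - F x) * jshift b G x + F x * (jshift b G x - G x))%J by ring.
    pose proof (jnorm_ge0 b) as Hb0.
    assert (HG4 : jnorm (jshift b G x) <= M * 4).
    { eapply Rle_trans; [apply jnorm_jshift_le; eassumption|]. apply Rmult_le_compat_l; lra. }
    replace (5 * (L * M) * jnorm b) with (L * jnorm b * (M * 4) + L * (M * jnorm b)) by ring.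
    apply jnorm_add_le; apply jnorm_mul_le; auto.
Qed.

Lemma jshift_lipschitz_jet_of_bound (D : nat -> R -> R) (n : nat) (B : R) :
  derivative_sequence D -> (forall (k : nat) x, (1 + n <= k <= 3 + n)%nat -> Rabs (D k x) <= B) ->
  jshift_lipschitz (jet_of D n) (3 * B).
Proof.
  intros HD HB b x Hb. unfold jnorm in *; simpl. rewrite Rplus_0_l.
  set (y := x + jval b). set (p := jval b) in *. set (q := jder1 b) in *. set (r := jder2 b) in *.
  assert (Hincr : forall k : nat, (n <= k <= 2 + n)%nat -> Rabs (D k y - D k x) <= B * Rabs p).
  { intros k Hk. apply (increment_bound (D k) (D (S k))); [|intros; apply HB; lia].
    intros z. apply is_derive_Reals, HD. }
  assert (Hmul : forall (k : nat) (e a : R), (1 + n <= k <= 3 + n)%nat -> Rabs e <= a -> Rabs (D k y * e) <= B * a).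
  { intros k e a Hk He. apply Rabs_mult_le; [apply HB, Hk|exact He]. }
  assert (Hder1 : Rabs (D (S n) y * (1 + q) + - D (S n) x) <= B * Rabs p + B * Rabs q).
  { replace (D (S n) y * (1 + q) + - D (S n) x) with ((D (S n) y - D (S n) x) + D (S n) y * q) by ring.
    apply Rabs_plus_le; [apply Hincr; lia|apply Hmul; [lia|apply Rle_refl]]. }
  assert (Hder2 : Rabs (D (S (S n)) y * ((1 + q) * (1 + q)) + D (S n) y * r + - D (S (S n)) x)
      <= B * Rabs p + B * (3 * Rabs q) + B * Rabs r).
  { replace (D (S (S n)) y * ((1 + q) * (1 + q)) + D (S n) y * r + - D (S (S n)) x)
      with ((D (S (S n)) y - D (S (S n)) x) + D (S (S n)) y * ((2 + q) * q) + D (S n) y * r) by ring.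
    repeat apply Rabs_plus_le; [apply Hincr; lia| |apply Hmul; [lia|apply Rle_refl]].
    apply Hmul; [lia|]. apply Rabs_mult_le; [|apply Rle_refl].
    pose proof (Rabs_triang 2 q) as Htriang. rewrite (Rabs_pos_eq 2) in Htriang by lra.
    pose proof (Rabs_pos p). pose proof (Rabs_pos r). lra. }
  pose proof (Hincr n ltac:(lia)) as Hval. unfold Rminus in Hval.
  assert (HB0 : 0 <= B) by exact (Rle_trans _ _ _ (Rabs_pos _) (HB (S n) x ltac:(lia))).
  pose proof (Rmult_le_pos _ _ HB0 (Rabs_pos p)). pose proof (Rmult_le_pos _ _ HB0 (Rabs_pos q)).
  pose proof (Rmult_le_pos _ _ HB0 (Rabs_pos r)). lra.
Qed.

Lemma jshift_lipschitz_jet_of (D : nat -> R -> R) (n : nat) :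
  derivative_sequence D -> (forall k : nat, (1 + n <= k <= 3 + n)%nat -> bounded_fun (D k)) ->
  exists L, jshift_lipschitz (jet_of D n) L.
Proof.
  intros HD HB. destruct (bounded_fun_common_bound D _ _ HB) as (B & _ & HB').
  exists (3 * B). apply jshift_lipschitz_jet_of_bound; assumption.
Qed.

Lemma jshift_stable_jet_of (D : nat -> R -> R) (n : nat) :
  derivative_sequence D -> (forall k : nat, (n <= k <= 3 + n)%nat -> bounded_fun (D k)) ->
  exists L, jshift_stable (jet_of D n) L.
Proof.
  intros HD HB. destruct (bounded_fun_common_bound D _ _ HB) as (B & _ & HB'). exists (3 * B). split.
  - intros x. unfold jnorm; simpl. pose proof (HB' n x ltac:(lia)). pose proof (HB' (S n) x ltac:(lia)).
    pose proof (HB' (S (S n)) x ltac:(lia)). pose proof (Rabs_pos (D (S (S n)) x)). lra.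
  - apply jshift_lipschitz_jet_of_bound; [exact HD|]. intros; apply HB'; lia.
Qed.

(** * Limits along a free ultrafilter *)

Class FreeUltrafilter (U : (nat -> Prop) -> Prop) : Prop := {
  ultra_proper :: ProperFilter U;
  ultra_decides : forall P : nat -> Prop, U P \/ U (fun n => ~ P n);
  ultra_free : filter_le U eventually }.

Lemma FreeUltrafilter_exists : exists U, FreeUltrafilter U.
Proof.
  destruct (filter.ultraFilterLemma filter.eventually_filter) as [U [HU Hfree]].
  pose proof (@filter.ultra_proper nat U HU) as HP.
  pose proof (@filter.filter_filter nat U HP) as HF.
  assert (Himp : forall P Q : nat -> Prop, (forall n, P n -> Q n) -> U P -> U Q).
  { intros P Q HPQ. exact (@filter.filterS nat U HF P Q HPQ). }
  exists U. split; [split; [|split]| |].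
  - intros P HUP. apply NNPP. intros Hn. apply (@filter.filter_not_empty nat U HP).
    apply (Himp P); [|exact HUP]. intros n Hp. apply Hn. exists n. exact Hp.
  - apply (Himp (@classical_sets.setT nat)); [intros; exact I|exact (@filter.filterT nat U HF)].
  - intros P Q HPU HQU. exact (@filter.filterI nat U HF P Q HPU HQU).
  - exact Himp.
  - intros P. exact (@filter.in_ultra_setVsetC nat U P HU).
  - intros P [N HN]. apply Hfree. exists N; [exact I|]. intros n Hn. apply HN.
    exact (ssrbool.elimT ssrnat.leP Hn).
Qed.

Section RealLimits.
Context {T : Type} {F : (T -> Prop) -> Prop} {HF : Filter F}.

Lemma filterlim_locally_R (f : T -> R) (l : R) :
  filterlim f F (locally l) <-> forall eps, 0 < eps -> F (fun x => Rabs (f x - l) < eps).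
Proof.
  rewrite filterlim_locally. split.
  - intros H eps He. exact (H (mkposreal eps He)).
  - intros H eps. exact (H eps (cond_pos eps)).
Qed.

Lemma filterlim_Rplus (f g : T -> R) (l m : R) :
  filterlim f F (locally l) -> filterlim g F (locally m) -> filterlim (fun x => f x + g x) F (locally (l + m)).
Proof. intros Hf Hg. exact (filterlim_comp_2 f g Rplus Hf Hg (filterlim_plus l m)). Qed.

Lemma filterlim_Rmult (f g : T -> R) (l m : R) :
  filterlim f F (locally l) -> filterlim g F (locally m) -> filterlim (fun x => f x * g x) F (locally (l * m)).
Proof. intros Hf Hg. exact (filterlim_comp_2 f g Rmult Hf Hg (filterlim_mult l m)). Qed.

Lemma filterlim_Ropp (f : T -> R) (l : R) :
  filterlim f F (locally l) -> filterlim (fun x => - f x) F (locally (- l)).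
Proof. intros Hf. exact (filterlim_comp _ _ _ f Ropp F _ _ Hf (filterlim_opp l)). Qed.

Lemma filterlim_Rminus (f g : T -> R) (l m : R) :
  filterlim f F (locally l) -> filterlim g F (locally m) -> filterlim (fun x => f x - g x) F (locally (l - m)).
Proof. intros Hf Hg. exact (filterlim_Rplus _ _ _ _ Hf (filterlim_Ropp _ _ Hg)). Qed.

Lemma filterlim_Rinv (f : T -> R) (l : R) :
  l <> 0 -> filterlim f F (locally l) -> filterlim (fun x => / f x) F (locally (/ l)).
Proof.
  intros Hl Hf. apply (filterlim_comp _ _ _ f Rinv F _ _ Hf), (filterlim_Rbar_inv l).
  intros Efin. apply Hl. injection Efin. trivial.
Qed.

Lemma filterlim_Rabs_comp (f : T -> R) (l : R) :
  filterlim f F (locally l) -> filterlim (fun x => Rabs (f x)) F (locally (Rabs l)).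
Proof. intros Hf. exact (filterlim_comp _ _ _ f Rabs F _ _ Hf (filterlim_Rabs l)). Qed.

End RealLimits.

Lemma filterlim_Rle {T : Type} {F : (T -> Prop) -> Prop} {HF : ProperFilter F} (f g : T -> R) (l m : R) :
  F (fun x => f x <= g x) -> filterlim f F (locally l) -> filterlim g F (locally m) -> l <= m.
Proof. intros H Hf Hg. exact (filterlim_le f g l m H Hf Hg). Qed.

Section Ultralimits.
Context (U : (nat -> Prop) -> Prop) {HU : FreeUltrafilter U}.

Lemma ultra_bounded_cauchy (f : nat -> R) (B : R) : (forall n, Rabs (f n) <= B) -> cauchy (filtermap f U).
Proof.
  intros HB.
  destruct (completeness (fun y => U (fun n => y <= f n))) as [l [Hub Hlub]].
  - exists B. intros y Hy. destruct (filter_ex _ Hy) as [n Hn].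
    pose proof (Rle_abs (f n)). specialize (HB n). lra.
  - exists (- B). apply filter_forall. intros n.
    pose proof (Rabs_maj2 (f n)). specialize (HB n). lra.
  - intros eps. exists l. pose proof (cond_pos eps) as He. unfold filtermap.
    assert (Hlow : U (fun n => l - eps < f n)).
    { destruct (ultra_decides (fun n => l - eps < f n)) as [H|H]; [exact H|].
      assert (l <= l - eps); [|lra]. apply Hlub. intros y Hy.
      destruct (filter_ex _ (filter_and _ _ H Hy)) as [n [Hn Hfn]]. lra. }
    assert (Hup : U (fun n => ~ l + eps <= f n)).
    { destruct (ultra_decides (fun n => l + eps <= f n)) as [H|H]; [|exact H].
      specialize (Hub _ H). lra. }
    generalize (filter_and _ _ Hlow Hup). apply filter_imp. intros n [Hn Hfn].
    apply Rabs_def1; unfold minus, plus, opp; simpl; lra.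
Qed.

Definition ulim (f : nat -> R) : R := lim (filtermap f U).

Lemma filterlim_ulim (f : nat -> R) (B : R) : (forall n, Rabs (f n) <= B) -> filterlim f U (locally (ulim f)).
Proof.
  intros HB. apply filterlim_locally. intros eps.
  exact (complete_cauchy (filtermap f U) _ (ultra_bounded_cauchy f B HB) eps).
Qed.

Lemma filterlim_RinvN : filterlim (fun n => RinvN n : R) U (locally 0).
Proof.
  apply (filterlim_filter_le_1 _ ultra_free). exact (proj2 (is_lim_seq_Reals _ 0) RinvN_cv).
Qed.

Lemma RinvN_eventually_lt (e : R) : 0 < e -> U (fun n => RinvN n < e).
Proof.
  intros He. generalize (proj1 (filterlim_locally_R _ _) filterlim_RinvN e He).
  apply filter_imp. intros n Hn. rewrite Rminus_0_r in Hn. apply Rabs_def2 in Hn. lra.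
Qed.

End Ultralimits.

(** * Passing to the limit in a time discretisation *)

Definition step_index (n : nat) (t : R) : nat := Z.to_nat (Int_part (t / RinvN n)).

Lemma step_index_spec (n : nat) (t : R) :
  0 <= t -> INR (step_index n t) * RinvN n <= t < (INR (step_index n t) + 1) * RinvN n.
Proof.
  intros Ht. pose proof (cond_pos (RinvN n)) as Hh. unfold step_index. set (y := t / RinvN n).
  assert (Hy : 0 <= y) by (apply Rdiv_le_0_compat; assumption).
  destruct (base_Int_part y) as [Hle Hgt].
  assert (Hz : (0 <= Int_part y)%Z).
  { assert (-1 < Int_part y)%Z by (apply lt_IZR; lra). lia. }
  rewrite INR_IZR_INZ, Z2Nat.id by exact Hz.
  assert (Et : t = y * RinvN n) by (unfold y; field; lra).
  rewrite Et. split; [apply Rmult_le_compat_r|apply Rmult_lt_compat_r]; lra.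
Qed.

Lemma step_index_mul (n k : nat) : step_index n (INR k * RinvN n) = k.
Proof.
  pose proof (cond_pos (RinvN n)) as Hh. pose proof (pos_INR k) as Hk.
  destruct (step_index_spec n (INR k * RinvN n)) as [Hle Hlt]; [apply Rmult_le_pos; lra|].
  apply Rmult_le_reg_r in Hle; [|exact Hh]. apply Rmult_lt_reg_r in Hlt; [|exact Hh].
  apply INR_le in Hle. rewrite <- S_INR in Hlt. apply INR_lt in Hlt. lia.
Qed.

Lemma step_index_0 (n : nat) : step_index n 0 = 0%nat.
Proof. rewrite <- (step_index_mul n 0). f_equal. simpl. ring. Qed.

Lemma step_index_le (n : nat) (s t : R) : 0 <= s <= t -> (step_index n s <= step_index n t)%nat.
Proof.
  intros Hst. pose proof (cond_pos (RinvN n)) as Hh.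
  destruct (step_index_spec n s) as [Hs _]; [lra|]. destruct (step_index_spec n t) as [_ Ht]; [lra|].
  assert (H : INR (step_index n s) < INR (step_index n t) + 1) by (apply Rmult_lt_reg_r with (RinvN n); lra).
  rewrite <- S_INR in H. apply INR_lt in H. lia.
Qed.

Lemma filterlim_step_time (U : (nat -> Prop) -> Prop) {HU : FreeUltrafilter U} (t : R) :
  0 <= t -> filterlim (fun n => INR (step_index n t) * RinvN n) U (locally t).
Proof.
  intros Ht. apply filterlim_locally_R. intros eps He.
  generalize (RinvN_eventually_lt U eps He). apply filter_imp. intros n Hn.
  destruct (step_index_spec n t Ht). apply Rabs_def1; lra.
Qed.

Lemma telescoping_bound (a : nat -> R) (g c : R) (i j : nat) :
  (i <= j)%nat -> (forall k, (i <= k < j)%nat -> Rabs (a (S k) - a k - g) <= c) ->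
  Rabs (a j - a i - (INR j - INR i) * g) <= (INR j - INR i) * c.
Proof.
  intros Hij. induction Hij as [|j Hij IH]; intros H.
  - replace (a i - a i - (INR i - INR i) * g) with 0 by ring. rewrite Rabs_R0. lra.
  - rewrite S_INR.
    replace (a (S j) - a i - (INR j + 1 - INR i) * g)
      with ((a (S j) - a j - g) + (a j - a i - (INR j - INR i) * g)) by ring.
    replace ((INR j + 1 - INR i) * c) with (c + (INR j - INR i) * c) by ring.
    apply Rabs_plus_le; [apply H; lia|apply IH; intros; apply H; lia].
Qed.

Lemma Rabs_div_lt (a h eps : R) : h <> 0 -> Rabs a < eps * Rabs h -> Rabs (a / h) < eps.
Proof. intros Hh Ha. rewrite Rabs_div by exact Hh. apply Rlt_div_l; [apply Rabs_pos_lt, Hh|exact Ha]. Qed.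

Lemma quadratic_lt_linear (C eps h : R) :
  0 <= C -> 0 < eps -> h <> 0 -> Rabs h < eps / (C + 1) -> C * h ^ 2 < eps * Rabs h.
Proof.
  intros HC He Hh Hlt. apply Rlt_div_r in Hlt; [|lra]. rewrite <- pow2_abs.
  pose proof (Rabs_pos_lt h Hh) as Hpos. replace (C * Rabs h ^ 2) with ((C * Rabs h) * Rabs h) by ring.
  apply Rmult_lt_compat_r; lra.
Qed.

(* [f n k] is the [k]-th iterate, at time [k * RinvN n], of a scheme with initial value [f0]. *)
Definition lipschitz_grid (delta K : R) (f : nat -> nat -> R -> R) (f0 : R -> R) : Prop :=
  0 <= K /\ (forall n x, f n 0%nat x = f0 x) /\
  (forall n k x, INR (S k) * RinvN n <= delta -> Rabs (f n (S k) x - f n k x) <= K * RinvN n) /\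
  (forall n k x y, INR k * RinvN n <= delta -> Rabs (f n k y - f n k x) <= K * Rabs (y - x)).

Lemma step_index_le_delta (delta : R) (n : nat) (t : R) :
  0 <= t <= delta -> INR (step_index n t) * RinvN n <= delta.
Proof. intros Ht. destruct (step_index_spec n t); lra. Qed.

Section GridLimits.
Context (U : (nat -> Prop) -> Prop) {HU : FreeUltrafilter U}.

Definition grid_limit (f : nat -> nat -> R -> R) (t x : R) : R := ulim U (fun n => f n (step_index n t) x).

Context {delta K : R} {f : nat -> nat -> R -> R} {f0 : R -> R}.
Hypothesis f_grid : lipschitz_grid delta K f f0.

Let K_ge0 : 0 <= K := proj1 f_grid.
Let f_initial : forall n x, f n 0%nat x = f0 x := proj1 (proj2 f_grid).

Lemma grid_time_lipschitz (n : nat) (s t x : R) : 0 <= s <= delta -> 0 <= t <= delta ->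
  Rabs (f n (step_index n t) x - f n (step_index n s) x) <= K * (Rabs (t - s) + RinvN n).
Proof.
  pose proof (cond_pos (RinvN n)) as Hh.
  assert (Hordered : forall s t, 0 <= s <= t -> t <= delta ->
    Rabs (f n (step_index n t) x - f n (step_index n s) x) <= K * (t - s + RinvN n)).
  { clear s t. intros s t Hs Ht. pose proof (step_index_le n s t Hs) as Hle.
    destruct (step_index_spec n s) as [_ Hs_idx]; [lra|]. destruct (step_index_spec n t) as [Ht_idx _]; [lra|].
    pose proof (telescoping_bound (fun k => f n k x) 0 (K * RinvN n) _ _ Hle) as Hsum.
    rewrite Rmult_0_r, Rminus_0_r in Hsum. eapply Rle_trans; [apply Hsum|].
    - intros k Hk. rewrite Rminus_0_r. apply f_grid.
      apply Rle_trans with (INR (step_index n t) * RinvN n); [|lra].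
      apply Rmult_le_compat_r; [lra|apply le_INR; lia].
    - rewrite (Rmult_comm K (RinvN n)), <- Rmult_assoc, (Rmult_comm _ K). apply Rmult_le_compat_l; lra. }
  intros Hs Ht. destruct (Rle_dec s t) as [Hst|Hts].
  - rewrite (Rabs_pos_eq (t - s)) by lra. apply Hordered; lra.
  - rewrite Rabs_minus_sym, (Rabs_minus_sym t s), (Rabs_pos_eq (s - t)) by lra. apply Hordered; lra.
Qed.

Lemma grid_space_lipschitz (n : nat) (t x y : R) : 0 <= t <= delta ->
  Rabs (f n (step_index n t) y - f n (step_index n t) x) <= K * Rabs (y - x).
Proof. intros Ht. apply f_grid, step_index_le_delta, Ht. Qed.

Lemma filterlim_grid_limit (t x : R) : 0 <= t <= delta ->
  filterlim (fun n => f n (step_index n t) x) U (locally (grid_limit f t x)).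
Proof.
  intros Ht. apply (filterlim_ulim U _ (K * (delta + 1) + Rabs (f0 x))). intros n.
  pose proof (grid_time_lipschitz n 0 t x ltac:(lra) Ht) as H. rewrite step_index_0, f_initial in H.
  replace (f n (step_index n t) x) with ((f n (step_index n t) x - f0 x) + f0 x) by ring.
  apply Rabs_plus_le; [|lra]. eapply Rle_trans; [exact H|]. apply Rmult_le_compat_l; [exact K_ge0|].
  assert (Hh : RinvN n <= 1).
  { simpl. rewrite <- Rinv_1. apply Rinv_le_contravar; [lra|]. pose proof (pos_INR n). lra. }
  rewrite Rabs_pos_eq; lra.
Qed.

Lemma grid_limit_0 (x : R) : 0 <= delta -> grid_limit f 0 x = f0 x.
Proof.
  intros Hd. apply (filterlim_locally_unique (V := R_NormedModule) (F := U) (fun n => f n (step_index n 0) x));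
    [apply filterlim_grid_limit; lra|].
  apply (filterlim_ext (fun _ => f0 x)); [|apply filterlim_const].
  intros n. rewrite step_index_0, f_initial. reflexivity.
Qed.

Lemma grid_limit_lipschitz (s t x y : R) : 0 <= s <= delta -> 0 <= t <= delta ->
  Rabs (grid_limit f t y - grid_limit f s x) <= K * Rabs (t - s) + K * Rabs (y - x).
Proof.
  intros Hs Ht.
  apply (filterlim_Rle (F := U) (fun n => Rabs (f n (step_index n t) y - f n (step_index n s) x))
    (fun n => K * (Rabs (t - s) + RinvN n) + K * Rabs (y - x))).
  - apply filter_forall. intros n.
    replace (f n (step_index n t) y - f n (step_index n s) x)
      with ((f n (step_index n t) x - f n (step_index n s) x)
        + (f n (step_index n t) y - f n (step_index n t) x)) by ring.
    apply Rabs_plus_le; [apply grid_time_lipschitz|apply grid_space_lipschitz]; assumption.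
  - apply filterlim_Rabs_comp, filterlim_Rminus; apply filterlim_grid_limit; assumption.
  - rewrite <- (Rplus_0_r (Rabs (t - s))) at 1.
    apply filterlim_Rplus; [|apply filterlim_const]. apply filterlim_Rmult; [apply filterlim_const|].
    apply filterlim_Rplus; [apply filterlim_const|apply (filterlim_RinvN U)].
Qed.

Lemma grid_limit_cont : cont_strip delta (grid_limit f).
Proof.
  intros t x Ht eps He. assert (Hd : 0 < eps / (2 * K + 1)) by (apply Rdiv_lt_0_compat; lra).
  exists (eps / (2 * K + 1)). split; [exact Hd|]. intros t' x' Ht' Htt Hxx.
  eapply Rle_lt_trans; [apply grid_limit_lipschitz; assumption|].
  apply Rlt_div_r in Htt; [|lra]. apply Rlt_div_r in Hxx; [|lra].
  pose proof (Rabs_pos (t' - t)). pose proof (Rabs_pos (x' - x)).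
  destruct (Rle_dec (Rabs (t' - t)) (Rabs (x' - x))); nra.
Qed.

Lemma filterlim_grid_limit_joint (t x : R) : 0 <= t <= delta ->
  filterlim (fun q => f (fst q) (step_index (fst q) (snd q)) x)
    (filter_prod U (within (fun s => 0 <= s <= delta) (locally t))) (locally (grid_limit f t x)).
Proof.
  intros Ht. apply filterlim_locally_R. intros eps He.
  set (d := eps / (4 * (K + 1))).
  assert (Hd : 0 < d) by (apply Rdiv_lt_0_compat; lra).
  assert (Ed : (K + 1) * d = eps / 4) by (unfold d; field; lra).
  apply (Filter_prod _ _ _ (fun n => Rabs (f n (step_index n t) x - grid_limit f t x) < eps / 2 /\ RinvN n < d)
    (fun s => 0 <= s <= delta /\ Rabs (s - t) < d)).
  - apply filter_and; [|exact (RinvN_eventually_lt U d Hd)].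
    apply (proj1 (filterlim_locally_R _ _) (filterlim_grid_limit t x Ht)). lra.
  - exists (mkposreal d Hd). intros s Hs Hsd. split; [exact Hsd|exact Hs].
  - intros n s [Hlim Hstep] [Hs Hst]. simpl.
    pose proof (grid_time_lipschitz n t s x Ht Hs) as Hlip.
    assert (K * (Rabs (s - t) + RinvN n) <= K * (2 * d)) by (apply Rmult_le_compat_l; lra).
    pose proof (Rabs_triang (f n (step_index n s) x - f n (step_index n t) x)
      (f n (step_index n t) x - grid_limit f t x)) as Htriang.
    replace (f n (step_index n s) x - f n (step_index n t) x + (f n (step_index n t) x - grid_limit f t x))
      with (f n (step_index n s) x - grid_limit f t x) in Htriang by ring.
    lra.
Qed.

Section TimeDerivative.
Variable G : nat -> nat -> R -> R.
Hypothesis f_consistent : forall n k x, (1 <= k)%nat -> INR (S k) * RinvN n <= delta ->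
  Rabs (f n (S k) x - f n k x - RinvN n * G n k x) <= K * RinvN n ^ 2.

Lemma grid_increment_bound (n : nat) (a b x g eps : R) :
  0 <= a <= b -> b <= delta -> 0 <= eps -> (1 <= step_index n a)%nat ->
  (forall k, (step_index n a <= k < step_index n b)%nat -> Rabs (G n k x - g) <= eps) ->
  Rabs (f n (step_index n b) x - f n (step_index n a) x - (b - a) * g)
    <= (b - a + RinvN n) * (eps + K * RinvN n) + RinvN n * Rabs g.
Proof.
  intros Hab Hb He Hka HG. pose proof (cond_pos (RinvN n)) as Hh. pose proof (step_index_le n a b Hab) as Hle.
  destruct (step_index_spec n a) as [Ha_le Ha_lt]; [lra|]. destruct (step_index_spec n b) as [Hb_le Hb_lt]; [lra|].
  set (i := step_index n a) in *. set (j := step_index n b) in *. set (h := RinvN n : R) in *.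
  assert (Hsum : Rabs (f n j x - f n i x - (INR j - INR i) * (h * g)) <= (INR j - INR i) * (h * (eps + K * h))).
  { apply (telescoping_bound (fun k => f n k x)); [exact Hle|]. intros k Hk.
    replace (f n (S k) x - f n k x - h * g)
      with ((f n (S k) x - f n k x - h * G n k x) + h * (G n k x - g)) by ring.
    replace (h * (eps + K * h)) with (K * h ^ 2 + h * eps) by ring.
    apply Rabs_plus_le.
    - apply f_consistent; [lia|]. apply Rle_trans with (INR j * h); [|lra].
      apply Rmult_le_compat_r; [lra|apply le_INR; lia].
    - apply Rabs_mult_le; [rewrite Rabs_pos_eq; lra|apply HG, Hk]. }
  replace (f n j x - f n i x - (b - a) * g)
    with ((f n j x - f n i x - (INR j - INR i) * (h * g)) + ((INR j - INR i) * h - (b - a)) * g) by ring.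
  apply Rabs_plus_le.
  - eapply Rle_trans; [exact Hsum|]. rewrite <- Rmult_assoc. apply Rmult_le_compat_r; [|lra].
    pose proof (Rmult_le_pos K h K_ge0 (Rlt_le _ _ Hh)). lra.
  - apply Rabs_mult_le; [apply Rabs_le; lra|apply Rle_refl].
Qed.

Lemma grid_limit_increment (t x g eps d a b : R) :
  0 <= eps -> 0 < a <= b -> b <= delta -> t - d < a -> b < t + d ->
  U (fun n => forall s, 0 <= s <= delta -> Rabs (s - t) < d -> Rabs (G n (step_index n s) x - g) < eps) ->
  Rabs (grid_limit f b x - grid_limit f a x - (b - a) * g) <= (b - a) * eps.
Proof.
  intros He Hab Hb Hta Hbt HG.
  apply (filterlim_Rle (F := U) (fun n => Rabs (f n (step_index n b) x - f n (step_index n a) x - (b - a) * g))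
    (fun n => (b - a + RinvN n) * (eps + K * RinvN n) + RinvN n * Rabs g)).
  - assert (Hr : 0 < Rmin a (a - (t - d))) by (apply Rmin_glb_lt; lra).
    generalize (filter_and _ _ HG (RinvN_eventually_lt U _ Hr)). apply filter_imp. intros n [HGn Hn].
    pose proof (Rmin_l a (a - (t - d))). pose proof (Rmin_r a (a - (t - d))). pose proof (cond_pos (RinvN n)).
    destruct (step_index_spec n a) as [_ Ha_lt]; [lra|]. destruct (step_index_spec n b) as [Hb_le _]; [lra|].
    apply grid_increment_bound; try lra.
    + destruct (step_index n a); [change (INR 0) with 0 in Ha_lt; lra|lia].
    + intros k [Hak Hkb]. rewrite <- (step_index_mul n k). apply le_INR in Hak. apply lt_INR in Hkb.
      assert (INR (step_index n a) * RinvN n <= INR k * RinvN n) by (apply Rmult_le_compat_r; lra).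
      assert (INR k * RinvN n <= INR (step_index n b) * RinvN n) by (apply Rmult_le_compat_r; lra).
      assert (0 <= INR k * RinvN n) by (apply Rmult_le_pos; [apply pos_INR|lra]).
      left. apply HGn; [lra|apply Rabs_def1; lra].
  - apply filterlim_Rabs_comp, filterlim_Rminus; [|apply filterlim_const].
    apply filterlim_Rminus; apply filterlim_grid_limit; lra.
  - replace ((b - a) * eps) with ((b - a + 0) * (eps + K * 0) + 0 * Rabs g) by ring.
    repeat first [apply (filterlim_RinvN U)|apply filterlim_const|apply filterlim_Rplus|apply filterlim_Rmult].
Qed.

Lemma grid_limit_derive_t (t x g : R) : 0 < t <= delta ->
  filterlim (fun q => G (fst q) (step_index (fst q) (snd q)) x)
    (filter_prod U (within (fun s => 0 <= s <= delta) (locally t))) (locally g) ->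
  forall eps, 0 < eps -> exists d, 0 < d /\
    forall h, h <> 0 -> Rabs h < d -> 0 <= t + h <= delta ->
      Rabs ((grid_limit f (t + h) x - grid_limit f t x) / h - g) < eps.
Proof.
  intros Ht HG eps He.
  destruct (proj1 (filterlim_locally_R _ _) HG (eps / 2) ltac:(lra)) as [P Q HP [d HQ] HPQ].
  exists (Rmin d t). split; [apply Rmin_glb_lt; [apply cond_pos|lra]|]. intros h Hh Hhd Hth.
  pose proof (Rmin_l d t). pose proof (Rmin_r d t). apply Rabs_def2 in Hhd.
  assert (Hnear : U (fun n => forall s, 0 <= s <= delta -> Rabs (s - t) < d ->
    Rabs (G n (step_index n s) x - g) < eps / 2)).
  { revert HP. apply filter_imp. intros n Hn s Hs Hst. exact (HPQ n s Hn (HQ s Hst Hs)). }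
  replace ((grid_limit f (t + h) x - grid_limit f t x) / h - g)
    with ((grid_limit f (t + h) x - grid_limit f t x - h * g) / h) by (field; exact Hh).
  apply Rabs_div_lt; [exact Hh|].
  apply Rle_lt_trans with (Rabs h * (eps / 2)); [|pose proof (Rabs_pos_lt h Hh); nra].
  destruct (Rle_dec 0 h) as [Hp|Hn].
  - rewrite (Rabs_pos_eq h) by exact Hp. replace h with (t + h - t) at 2 3 by ring.
    apply (grid_limit_increment t x g (eps / 2) d); try assumption; lra.
  - rewrite (Rabs_left h), Rabs_minus_sym by lra.
    replace (h * g - (grid_limit f (t + h) x - grid_limit f t x))
      with (grid_limit f t x - grid_limit f (t + h) x - (t - (t + h)) * g) by ring.
    replace (- h) with (t - (t + h)) by ring.
    apply (grid_limit_increment t x g (eps / 2) d); try assumption; lra.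
Qed.

End TimeDerivative.

End GridLimits.

Lemma grid_limit_pderiv_x (U : (nat -> Prop) -> Prop) {HU : FreeUltrafilter U} {delta K : R}
    {f f' : nat -> nat -> R -> R} {f0 f0' : R -> R} :
  lipschitz_grid delta K f f0 -> lipschitz_grid delta K f' f0' ->
  (forall n k x d, INR k * RinvN n <= delta -> Rabs (f n k (x + d) - f n k x - d * f' n k x) <= K * d ^ 2) ->
  pderiv_x delta (grid_limit U f) (grid_limit U f').
Proof.
  intros Hf Hf' Htaylor t x Ht eps He. pose proof (proj1 Hf) as HK.
  assert (Hquadratic : forall d,
    Rabs (grid_limit U f t (x + d) - grid_limit U f t x - d * grid_limit U f' t x) <= K * d ^ 2).
  { intros d. apply (filterlim_Rle (F := U) (fun n => Rabs (f n (step_index n t) (x + d) - f n (step_index n t) x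
      - d * f' n (step_index n t) x)) (fun _ => K * d ^ 2)).
    - apply filter_forall. intros n. apply Htaylor, step_index_le_delta, Ht.
    - pose proof (fun y => filterlim_grid_limit U Hf t y Ht) as Hlim.
      apply filterlim_Rabs_comp, filterlim_Rminus; [apply filterlim_Rminus; apply Hlim|].
      apply filterlim_Rmult; [apply filterlim_const|].
      exact (filterlim_grid_limit U Hf' t x Ht).
    - apply filterlim_const. }
  assert (Hd : 0 < eps / (K + 1)) by (apply Rdiv_lt_0_compat; lra).
  exists (mkposreal _ Hd). simpl. intros h Hh Hhd.
  replace ((grid_limit U f t (x + h) - grid_limit U f t x) / h - grid_limit U f' t x)
    with ((grid_limit U f t (x + h) - grid_limit U f t x - h * grid_limit U f' t x) / h) by (field; exact Hh).
  apply Rabs_div_lt; [exact Hh|]. eapply Rle_lt_trans; [apply Hquadratic|]. apply quadratic_lt_linear; assumption.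
Qed.

(** * Cauchy problems with a singular source *)

Definition strip_at (delta t x : R) : (R * R -> Prop) -> Prop :=
  filter_prod (within (fun s => 0 <= s <= delta) (locally t)) (locally x).

#[export] Instance strip_at_filter (delta t x : R) : Filter (strip_at delta t x).
Proof. apply filter_prod_filter; [apply within_filter|]; apply locally_filter. Qed.

Lemma filterlim_strip_at (delta : R) (G : R -> R -> R) (t x l : R) :
  filterlim (fun q => G (fst q) (snd q)) (strip_at delta t x) (locally l) <->
  (forall eps, 0 < eps -> exists d, 0 < d /\ forall t' x', 0 <= t' <= delta ->
    Rabs (t' - t) < d -> Rabs (x' - x) < d -> Rabs (G t' x' - l) < eps).
Proof.
  rewrite filterlim_locally_R. split; intros H eps He.
  - destruct (H eps He) as [P Q [d1 HP] [d2 HQ] HPQ]. exists (Rmin d1 d2).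
    split; [apply Rmin_glb_lt; apply cond_pos|]. intros t' x' Ht' Htt Hxx.
    apply HPQ; [apply HP; [|exact Ht']|apply HQ]; (eapply Rlt_le_trans; [eassumption|]); [apply Rmin_l|apply Rmin_r].
  - destruct (H eps He) as [d [Hd HG]].
    apply (Filter_prod _ _ _ (fun s => 0 <= s <= delta /\ Rabs (s - t) < d) (fun y => Rabs (y - x) < d)).
    + exists (mkposreal d Hd). intros s Hs Hsd. split; [exact Hsd|exact Hs].
    + exists (mkposreal d Hd). intros y Hy. exact Hy.
    + intros s y [Hs Htt] Hxx. exact (HG s y Hs Htt Hxx).
Qed.

Lemma jnorm_limit_le {T : Type} (F : (T -> Prop) -> Prop) {HF : ProperFilter F} (w : T -> jet) (l : jet)
    (c : T -> R) (d : R) :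
  filterlim (fun q => jval (w q)) F (locally (jval l)) -> filterlim (fun q => jder1 (w q)) F (locally (jder1 l)) ->
  filterlim (fun q => jder2 (w q)) F (locally (jder2 l)) -> filterlim c F (locally d) ->
  F (fun q => jnorm (w q) <= c q) -> jnorm l <= d.
Proof.
  intros H0 H1 H2 Hc Hle. apply (filterlim_Rle _ _ _ _ Hle); [|exact Hc]. unfold jnorm, Rdiv.
  repeat apply filterlim_Rplus; repeat first [apply filterlim_Rmult|apply filterlim_const];
    apply filterlim_Rabs_comp; assumption.
Qed.

Section JetOperators.
Variables (I : Type) (D : (I -> R) -> Prop).

Definition jet_operator_on (f : (I -> jet) -> jet) : Prop :=
  (forall (W : R -> I -> jet) (x : R), (forall j, holonomic_at (fun y => W y j) x) ->
    D (fun j => jval (W x j)) -> holonomic_at (fun y => f (W y)) x) /\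
  (forall (T : Type) (F : (T -> Prop) -> Prop), Filter F -> forall (w : T -> I -> jet) (l : I -> jet),
    D (fun j => jval (l j)) -> (forall j, filterlim (fun q => jval (w q j)) F (locally (jval (l j)))) ->
    filterlim (fun q => jval (f (w q))) F (locally (jval (f l)))).

Lemma jet_operator_const (r : R) : jet_operator_on (fun _ => jconst r).
Proof. split; intros; [apply holonomic_const|apply filterlim_const]. Qed.

Lemma jet_operator_coord (j : I) : jet_operator_on (fun w => w j).
Proof. split; auto. Qed.

Lemma jet_operator_add (f g : (I -> jet) -> jet) :
  jet_operator_on f -> jet_operator_on g -> jet_operator_on (fun w => f w + g w)%J.
Proof.
  intros [f1 f2] [g1 g2]. split; intros; [apply holonomic_add; auto|].
  apply filterlim_Rplus; [apply f2|apply g2]; assumption.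
Qed.

Lemma jet_operator_opp (f : (I -> jet) -> jet) : jet_operator_on f -> jet_operator_on (fun w => - f w)%J.
Proof.
  intros [f1 f2]. split; intros; [apply holonomic_opp; auto|].
  apply filterlim_Ropp, f2; assumption.
Qed.

Lemma jet_operator_sub (f g : (I -> jet) -> jet) :
  jet_operator_on f -> jet_operator_on g -> jet_operator_on (fun w => f w - g w)%J.
Proof. intros Hf Hg. apply jet_operator_add, jet_operator_opp; assumption. Qed.

Lemma jet_operator_mul (f g : (I -> jet) -> jet) :
  jet_operator_on f -> jet_operator_on g -> jet_operator_on (fun w => f w * g w)%J.
Proof.
  intros [f1 f2] [g1 g2]. split; intros; [apply holonomic_mul; auto|].
  apply filterlim_Rmult; [apply f2|apply g2]; assumption.
Qed.

Lemma jet_operator_comp (F : R -> jet) (f : (I -> jet) -> jet) :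
  holonomic F -> jet_operator_on f -> jet_operator_on (fun w => jcomp F (f w)).
Proof.
  intros HF [f1 f2]. split; intros.
  - apply holonomic_comp; [apply HF|auto].
  - apply (filterlim_comp _ _ _ (fun q => jval (f (w q))) (fun r => jval (F r)) _ (locally (jval (f l)))).
    + apply f2; assumption.
    + apply (ex_derive_continuous (fun r => jval (F r))). exists (jder1 (F (jval (f l)))). apply HF.
Qed.

Lemma jet_operator_inv (f : (I -> jet) -> jet) :
  (forall w, D (fun j => jval (w j)) -> jval (f w) <> 0) -> jet_operator_on f -> jet_operator_on (fun w => / f w)%J.
Proof.
  intros Hn [f1 f2]. split; intros.
  - apply holonomic_inv; auto.
  - apply filterlim_Rinv; [apply Hn; assumption|]. apply f2; assumption.
Qed.

End JetOperators.

Lemma jshift_step_remainder (A M sigma tau delta t h : R) (b s : jet) (F g f : R -> jet) (x : R) :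
  0 < t -> 0 < h -> t + h <= delta -> delta <= 1 -> 0 <= A -> 0 <= M -> 0 <= sigma -> sigma * delta <= 1 ->
  tau + 2 * A * sigma + 3 * sigma * M * delta ^ 2 <= 2 * M ->
  jshift_lipschitz g A -> jshift_lipschitz f A -> jnorm b <= sigma * t ->
  (forall y, jnorm (F y - (g y + jconst t * f y)) <= M * t ^ 2) -> jnorm (s - f x) <= tau * t ->
  jnorm (jshift (jconst h * b) F x + jconst h * s - (g x + jconst (t + h) * f x)) <= M * (t + h) ^ 2.
Proof.
  intros Ht Hh Hth Hd HA HM Hsig Hsd Hinv Hg Hf Hb HF Hs.
  set (B := (jconst h * b)%J).
  assert (He : jnorm B <= h * (sigma * t)) by (apply jnorm_scale_le; [lra|exact Hb]).
  assert (Hst : 0 <= sigma * t <= 1).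
  { split; [apply Rmult_le_pos; lra|]. apply Rle_trans with (sigma * delta); [apply Rmult_le_compat_l|]; lra. }
  assert (He1 : jnorm B <= 1) by nra.
  set (r := fun y => (F y - (g y + jconst t * f y))%J).
  assert (Hr : jshift B r x = (jshift B F x - (jshift B g x + jconst t * jshift B f x))%J)
    by (apply jet_ext; simpl; ring).
  replace (jshift B F x + jconst h * s - (g x + jconst (t + h) * f x))%J
    with (jshift B r x + (jshift B g x - g x) + jconst t * (jshift B f x - f x) + jconst h * (s - f x))%J
    by (rewrite Hr, jconst_add; ring).
  apply Rle_trans with (M * t ^ 2 * (1 + 3 * (h * (sigma * t))) + A * (h * (sigma * t))
      + t * (A * (h * (sigma * t))) + h * (tau * t)).
  - repeat apply jnorm_add_le.
    + eapply Rle_trans; [apply jnorm_jshift_le; [exact HF|exact He1]|]. apply Rmult_le_compat_l; [|lra].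
      apply Rmult_le_pos; [exact HM|apply pow_le; lra].
    + eapply Rle_trans; [apply Hg, He1|]. apply Rmult_le_compat_l; assumption.
    + apply jnorm_scale_le; [lra|]. eapply Rle_trans; [apply Hf, He1|]. apply Rmult_le_compat_l; assumption.
    + apply jnorm_scale_le; [lra|exact Hs].
  - assert (Hht : 0 <= h * t) by (apply Rmult_le_pos; lra).
    assert (Hdrift : t * (A * sigma) <= 1 * (A * sigma)) by (apply Rmult_le_compat_r; [apply Rmult_le_pos|]; lra).
    assert (Hdilation : 3 * sigma * M * t ^ 2 <= 3 * sigma * M * delta ^ 2).
    { apply Rmult_le_compat_l; [repeat apply Rmult_le_pos; lra|]. apply pow_incr; lra. }
    pose proof (Rmult_le_compat_l (h * t) (tau + (A * sigma + t * (A * sigma)) + 3 * sigma * M * t ^ 2) (2 * M)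
      Hht ltac:(lra)) as Hgrowth.
    assert (0 <= M * (h * h)) by (repeat apply Rmult_le_pos; lra).
    simpl in Hgrowth |- *. lra.
Qed.

Section JshiftStepIncrement.
Variables (B N h : R) (b s : jet) (F : R -> jet) (x : R).
Hypothesis F_holonomic : holonomic F.
Hypothesis F_der1 : forall y, Rabs (jder1 (F y)) <= B.
Hypothesis F_der2 : forall y, Rabs (jder2 (F y)) <= B.
Hypothesis h_pos : 0 < h.
Hypothesis b_le1 : jnorm b <= 1.
Hypothesis s_le : jnorm s <= N.

Let next : jet := (jshift (jconst h * b) F x + jconst h * s)%J.

Lemma jshift_step_displacement : Rabs (h * jval b) <= h.
Proof.
  rewrite <- (Rmult_1_r h) at 2. apply Rabs_mult_le; [rewrite Rabs_pos_eq; lra|].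
  exact (Rle_trans _ _ _ (Rabs_jval_le b) b_le1).
Qed.

Lemma jshift_step_bound_ge0 : 0 <= B.
Proof. exact (Rle_trans _ _ _ (Rabs_pos _) (F_der1 0)). Qed.

Lemma jshift_step_value_increment : Rabs (jval next - jval (F x)) <= (2 * B + N) * h.
Proof.
  unfold next; simpl.
  replace (jval (F (x + h * jval b)) + h * jval s - jval (F x))
    with ((jval (F (x + h * jval b)) - jval (F x)) + h * jval s) by ring.
  replace ((2 * B + N) * h) with ((2 * B) * h + h * N) by ring. apply Rabs_plus_le.
  - eapply Rle_trans; [apply (increment_bound (fun y => jval (F y)) (fun y => jder1 (F y))); [|exact F_der1]|].
    + intros y. apply F_holonomic.
    + pose proof jshift_step_displacement. pose proof jshift_step_bound_ge0.
      pose proof (Rabs_pos (h * jval b)). nra.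
  - apply Rabs_mult_le; [rewrite Rabs_pos_eq; lra|]. exact (Rle_trans _ _ _ (Rabs_jval_le s) s_le).
Qed.

Lemma jshift_step_der1_increment : Rabs (jder1 next - jder1 (F x)) <= (2 * B + N) * h.
Proof.
  unfold next; simpl. set (y := x + h * jval b). pose proof jshift_step_bound_ge0.
  replace (_ - _) with ((jder1 (F y) - jder1 (F x)) + jder1 (F y) * (h * jder1 b) + h * jder1 s) by ring.
  replace ((2 * B + N) * h) with (B * h + B * (h * 1) + h * N) by ring.
  assert (Hh : Rabs h <= h) by (rewrite Rabs_pos_eq; lra).
  repeat apply Rabs_plus_le.
  - eapply Rle_trans; [apply (increment_bound (fun y => jder1 (F y)) (fun y => jder2 (F y))); [|exact F_der2]|].
    + intros z. apply F_holonomic.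
    + apply Rmult_le_compat_l; [assumption|apply jshift_step_displacement].
  - apply Rabs_mult_le; [apply F_der1|]. apply Rabs_mult_le; [exact Hh|].
    exact (Rle_trans _ _ _ (Rabs_jder1_le b) b_le1).
  - apply Rabs_mult_le; [exact Hh|]. exact (Rle_trans _ _ _ (Rabs_jder1_le s) s_le).
Qed.

Lemma jshift_step_consistent :
  Rabs (jval next - jval (F x) - h * (jval b * jder1 (F x) + jval s)) <= B * h ^ 2.
Proof.
  unfold next; simpl jval.
  replace (_ - _) with (jval (F (x + h * jval b)) - jval (F x) - h * jval b * jder1 (F x)) by ring.
  eapply Rle_trans; [apply (taylor_bound (fun y => jval (F y)) (fun y => jder1 (F y)) (fun y => jder2 (F y)));
    [| |exact F_der2]; intros y; apply F_holonomic|].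
  apply Rmult_le_compat_l; [apply jshift_step_bound_ge0|]. rewrite <- pow2_abs.
  apply pow_incr. split; [apply Rabs_pos|apply jshift_step_displacement].
Qed.

End JshiftStepIncrement.

Section SingularCauchyProblem.
Variables (I : Type) (speed source : I -> (I -> jet) -> jet) (base slope : R -> I -> jet).
Variables (domain : (I -> R) -> Prop) (delta A : R) (M sigma tau : I -> R).

Definition near (t x : R) (w : I -> jet) : Prop :=
  forall i, jnorm (w i - (base x i + jconst t * slope x i)) <= M i * t ^ 2.

Hypothesis delta_range : 0 < delta <= 1.
Hypothesis base_holonomic : forall i, holonomic (fun x => base x i).
Hypothesis slope_holonomic : forall i, holonomic (fun x => slope x i).
Hypothesis base_lipschitz : forall i, jshift_lipschitz (fun x => base x i) A.
Hypothesis slope_stable : forall i, jshift_stable (fun x => slope x i) A.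
Hypothesis speed_operator : forall i, jet_operator_on I domain (speed i).
Hypothesis source_operator : forall i, jet_operator_on I domain (source i).
Hypothesis near_domain : forall t x w, 0 < t <= delta -> near t x w -> domain (fun i => jval (w i)).
Hypothesis speed_near : forall t x w i, 0 < t <= delta -> near t x w -> jnorm (speed i w) <= sigma i * t.
Hypothesis source_near : forall t x w i, 0 < t <= delta -> near t x w ->
  jnorm (source i w - slope x i) <= tau i * t.
Hypothesis M_ge0 : forall i, 0 <= M i.
Hypothesis sigma_ge0 : forall i, 0 <= sigma i.
Hypothesis tau_ge0 : forall i, 0 <= tau i.
Hypothesis sigma_delta : forall i, sigma i * delta <= 1.
Hypothesis remainder_growth : forall i, tau i + 2 * A * sigma i + 3 * sigma i * M i * delta ^ 2 <= 2 * M i.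

Lemma slope_bound_ge0 (i : I) : 0 <= A.
Proof. exact (jshift_stable_ge0 (slope_stable i)). Qed.

Lemma near_sub_base (t x : R) (w : I -> jet) (i : I) : 0 <= t <= delta -> near t x w ->
  jnorm (w i - base x i) <= A + M i.
Proof.
  intros Ht Hw. pose proof (slope_bound_ge0 i) as HA. pose proof (M_ge0 i) as HM.
  replace (w i - base x i)%J with ((w i - (base x i + jconst t * slope x i)) + jconst t * slope x i)%J by ring.
  apply Rle_trans with (M i * t ^ 2 + t * A).
  - apply jnorm_add_le; [apply Hw|]. apply jnorm_scale_le; [lra|apply slope_stable].
  - assert (t ^ 2 <= 1) by (simpl; nra).
    pose proof (Rmult_le_compat_l (M i) _ _ HM H). pose proof (Rmult_le_compat_r A t 1 HA ltac:(lra)). lra.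
Qed.

Lemma near_der_bound (t x : R) (w : I -> jet) (i : I) : 0 <= t <= delta -> near t x w ->
  Rabs (jder1 (w i)) <= 3 * A + 2 * M i /\ Rabs (jder2 (w i)) <= 3 * A + 2 * M i.
Proof.
  intros Ht Hw. pose proof (near_sub_base t x w i Ht Hw) as Hsub.
  destruct (jshift_lipschitz_derivatives x (base_lipschitz i)) as [Hb1 Hb2].
  pose proof (slope_bound_ge0 i). pose proof (M_ge0 i).
  replace (w i) with ((w i - base x i) + base x i)%J by ring. split.
  - apply Rle_trans with ((A + M i) + A); [|lra].
    apply Rabs_plus_le; [exact (Rle_trans _ _ _ (Rabs_jder1_le _) Hsub)|exact Hb1].
  - apply Rle_trans with (2 * (A + M i) + A); [|lra].
    apply Rabs_plus_le; [|exact Hb2]. eapply Rle_trans; [apply Rabs_jder2_le|]. lra.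
Qed.

Definition euler_step (h : R) (W : R -> I -> jet) (x : R) (i : I) : jet :=
  (jshift (jconst h * speed i (W x)) (fun y => W y i) x + jconst h * source i (W x))%J.

(* The source may be singular at [t = 0]: there it is replaced by the prescribed time derivative. *)
Definition scheme (h : R) (k : nat) : R -> I -> jet :=
  match k with
  | O => base
  | S k => Nat.iter k (euler_step h) (fun x i => base x i + jconst h * slope x i)%J
  end.

Lemma euler_step_near (t h : R) (W : R -> I -> jet) : 0 < t -> 0 < h -> t + h <= delta ->
  (forall x, near t x (W x)) -> forall x, near (t + h) x (euler_step h W x).
Proof.
  intros Ht Hh Hth HW x i. assert (Htd : 0 < t <= delta) by lra.
  apply (jshift_step_remainder A (M i) (sigma i) (tau i) delta t h (speed i (W x)) (source i (W x)) (fun y => W y i)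
    (fun y => base y i) (fun y => slope y i)); try solve [assumption|lra|auto].
  - apply slope_bound_ge0, i.
  - apply slope_stable.
  - exact (speed_near t x (W x) i Htd (HW x)).
  - intros y. apply HW.
Qed.

Lemma euler_step_holonomic (t h : R) (W : R -> I -> jet) (i : I) : 0 < t <= delta ->
  (forall x, near t x (W x)) -> (forall j, holonomic (fun x => W x j)) -> holonomic (fun x => euler_step h W x i).
Proof.
  intros Ht HW Hhol x. assert (Hdom := near_domain t x (W x) Ht (HW x)).
  apply holonomic_add.
  - apply holonomic_comp; [apply Hhol|]. apply holonomic_add; [apply holonomic_var|].
    apply holonomic_mul; [apply holonomic_const|]. apply speed_operator; [intros; apply Hhol|exact Hdom].
  - apply holonomic_mul; [apply holonomic_const|].
    apply source_operator; [intros; apply Hhol|exact Hdom].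
Qed.

Lemma scheme_near_holonomic (h : R) (k : nat) : 0 < h -> INR k * h <= delta ->
  (forall x, near (INR k * h) x (scheme h k x)) /\ (forall i, holonomic (fun x => scheme h k x i)).
Proof.
  intros Hh. destruct k as [|k].
  - intros _. split; [intros x i|exact base_holonomic]. simpl INR. unfold scheme.
    rewrite Rmult_0_l. replace (base x i - (base x i + 0 * slope x i))%J with 0%J by ring.
    rewrite jnorm_0. simpl. lra.
  - induction k as [|k IH]; intros Hk.
    + split; [intros x i|intros i x; apply holonomic_add; [apply base_holonomic|apply holonomic_mul;
        [apply holonomic_const|apply slope_holonomic]]].
      simpl INR. rewrite Rmult_1_l. unfold scheme; simpl Nat.iter.
      replace (_ - _)%J with 0%J by ring. rewrite jnorm_0. apply Rmult_le_pos; [apply M_ge0|apply pow_le; lra].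
    + assert (Hpos : 0 < INR (S k) * h) by (apply Rmult_lt_0_compat; [apply lt_0_INR; lia|exact Hh]).
      rewrite (S_INR (S k)), Rmult_plus_distr_r, Rmult_1_l in *. destruct IH as [Hnear Hhol]; [lra|].
      split; [apply euler_step_near; assumption|].
      intros i. apply (euler_step_holonomic (INR (S k) * h)); [lra|assumption|exact Hhol].
Qed.

Definition rate (i : I) (w : I -> jet) : R := jval (speed i w) * jder1 (w i) + jval (source i w).

Definition der_bound (i : I) : R := 3 * A + 2 * M i.
Definition increment_cst (i : I) : R := 2 * der_bound i + (A + tau i).

Lemma der_bound_le (i : I) : 0 <= der_bound i <= increment_cst i.
Proof.
  pose proof (slope_bound_ge0 i). pose proof (M_ge0 i). pose proof (tau_ge0 i).
  unfold increment_cst, der_bound. lra.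
Qed.

Lemma source_near_bound (t x : R) (w : I -> jet) (i : I) : 0 < t <= delta -> near t x w ->
  jnorm (source i w) <= A + tau i.
Proof.
  intros Ht Hw. replace (source i w) with (slope x i + (source i w - slope x i))%J by ring.
  apply jnorm_add_le; [apply slope_stable|]. eapply Rle_trans; [apply (source_near t x w i Ht Hw)|].
  rewrite <- (Rmult_1_r (tau i)) at 2. apply Rmult_le_compat_l; [apply tau_ge0|lra].
Qed.

Lemma speed_near_le1 (t x : R) (w : I -> jet) (i : I) : 0 < t <= delta -> near t x w -> jnorm (speed i w) <= 1.
Proof.
  intros Ht Hw. eapply Rle_trans; [apply (speed_near t x w i Ht Hw)|].
  eapply Rle_trans; [apply Rmult_le_compat_l; [apply sigma_ge0|apply Ht]|apply sigma_delta].
Qed.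

Lemma scheme_succ (h : R) (k : nat) (x : R) (i : I) : 0 < h -> INR (S k) * h <= delta ->
  exists b s, jnorm b <= 1 /\ jnorm s <= A + tau i /\
    scheme h (S k) x i = (jshift (jconst h * b) (fun y => scheme h k y i) x + jconst h * s)%J /\
    ((1 <= k)%nat -> jval b * jder1 (scheme h k x i) + jval s = rate i (scheme h k x)).
Proof.
  intros Hh Hk. destruct k as [|k].
  - exists 0%J, (slope x i). pose proof (tau_ge0 i).
    split; [rewrite jnorm_0; lra|]. split; [eapply Rle_trans; [apply slope_stable|lra]|].
    split; [|lia]. replace (jconst h * 0)%J with 0%J by ring. rewrite jshift_0. reflexivity.
  - exists (speed i (scheme h (S k) x)), (source i (scheme h (S k) x)).
    rewrite (S_INR (S k)), Rmult_plus_distr_r, Rmult_1_l in Hk.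
    assert (Ht : 0 < INR (S k) * h <= delta).
    { split; [apply Rmult_lt_0_compat; [apply lt_0_INR; lia|exact Hh]|lra]. }
    destruct (scheme_near_holonomic h (S k) Hh (proj2 Ht)) as [Hnear _].
    split; [exact (speed_near_le1 _ x _ i Ht (Hnear x))|].
    split; [exact (source_near_bound _ x _ i Ht (Hnear x))|]. split; reflexivity.
Qed.

Section SchemeEstimates.
Variables (h : R) (k : nat).
Hypothesis h_pos : 0 < h.

Lemma scheme_der_bound (x : R) (i : I) : INR k * h <= delta ->
  Rabs (jder1 (scheme h k x i)) <= der_bound i /\ Rabs (jder2 (scheme h k x i)) <= der_bound i.
Proof.
  intros Hk. apply (near_der_bound (INR k * h) x (scheme h k x) i).
  - split; [apply Rmult_le_pos; [apply pos_INR|lra]|exact Hk].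
  - apply (scheme_near_holonomic h k h_pos Hk).
Qed.

Lemma scheme_increment (x : R) (i : I) : INR (S k) * h <= delta ->
  Rabs (jval (scheme h (S k) x i) - jval (scheme h k x i)) <= increment_cst i * h /\
  Rabs (jder1 (scheme h (S k) x i) - jder1 (scheme h k x i)) <= increment_cst i * h /\
  ((1 <= k)%nat -> Rabs (jval (scheme h (S k) x i) - jval (scheme h k x i) - h * rate i (scheme h k x))
    <= increment_cst i * h ^ 2).
Proof.
  intros Hk. destruct (scheme_succ h k x i h_pos Hk) as (b & s & Hb & Hs & -> & Hrate).
  assert (Hk' : INR k * h <= delta) by (rewrite S_INR in Hk; lra).
  destruct (scheme_near_holonomic h k h_pos Hk') as [_ Hhol].
  assert (Hder1 := fun y => proj1 (scheme_der_bound y i Hk')).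
  assert (Hder2 := fun y => proj2 (scheme_der_bound y i Hk')).
  split; [|split; [|intros Hk1; rewrite <- (Hrate Hk1)]].
  - exact (jshift_step_value_increment _ _ h b s _ x (Hhol i) Hder1 h_pos Hb Hs).
  - exact (jshift_step_der1_increment _ _ h b s _ x (Hhol i) Hder1 Hder2 h_pos Hb Hs).
  - eapply Rle_trans; [exact (jshift_step_consistent _ h b s _ x (Hhol i) Hder1 Hder2 h_pos Hb)|].
    apply Rmult_le_compat_r; [apply pow_le; lra|apply der_bound_le].
Qed.

Lemma scheme_space_increment (x y : R) (i : I) : INR k * h <= delta ->
  Rabs (jval (scheme h k y i) - jval (scheme h k x i)) <= increment_cst i * Rabs (y - x) /\
  Rabs (jder1 (scheme h k y i) - jder1 (scheme h k x i)) <= increment_cst i * Rabs (y - x).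
Proof.
  intros Hk. destruct (scheme_near_holonomic h k h_pos Hk) as [_ Hhol].
  assert (Hle : der_bound i * Rabs (y - x) <= increment_cst i * Rabs (y - x)).
  { apply Rmult_le_compat_r; [apply Rabs_pos|apply der_bound_le]. }
  replace y with (x + (y - x)) at 1 3 by ring. split; (eapply Rle_trans; [|exact Hle]).
  - apply (increment_bound (fun z => jval (scheme h k z i)) (fun z => jder1 (scheme h k z i)));
      intros z; [apply Hhol|apply scheme_der_bound, Hk].
  - apply (increment_bound (fun z => jder1 (scheme h k z i)) (fun z => jder2 (scheme h k z i)));
      intros z; [apply Hhol|apply scheme_der_bound, Hk].
Qed.

Lemma scheme_taylor (x d : R) (i : I) : INR k * h <= delta ->
  Rabs (jval (scheme h k (x + d) i) - jval (scheme h k x i) - d * jder1 (scheme h k x i)) <= increment_cst i * d ^ 2.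
Proof.
  intros Hk. destruct (scheme_near_holonomic h k h_pos Hk) as [_ Hhol].
  apply Rle_trans with (der_bound i * d ^ 2); [|apply Rmult_le_compat_r; [apply pow2_ge_0|apply der_bound_le]].
  apply (taylor_bound (fun z => jval (scheme h k z i)) (fun z => jder1 (scheme h k z i))
    (fun z => jder2 (scheme h k z i))); intros z; [apply Hhol|apply Hhol|apply scheme_der_bound, Hk].
Qed.

End SchemeEstimates.

Section Convergence.
Context (U : (nat -> Prop) -> Prop) {HU : FreeUltrafilter U}.

Let val (i : I) (n k : nat) (x : R) : R := jval (scheme (RinvN n) k x i).
Let der (i : I) (n k : nat) (x : R) : R := jder1 (scheme (RinvN n) k x i).

Definition limit_jet (t x : R) (i : I) : jet :=
  Jet (grid_limit U (val i) t x) (grid_limit U (der i) t x)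
      (grid_limit U (fun n k y => jder2 (scheme (RinvN n) k y i)) t x).

Lemma scheme_val_grid (i : I) : lipschitz_grid delta (increment_cst i) (val i) (fun x => jval (base x i)).
Proof.
  split; [pose proof (der_bound_le i); lra|]. split; [reflexivity|]. split.
  - intros n k x Hk. apply (scheme_increment _ k (cond_pos (RinvN n)) x i Hk).
  - intros n k x y Hk. apply (scheme_space_increment _ k (cond_pos (RinvN n)) x y i Hk).
Qed.

Lemma scheme_der_grid (i : I) : lipschitz_grid delta (increment_cst i) (der i) (fun x => jder1 (base x i)).
Proof.
  split; [pose proof (der_bound_le i); lra|]. split; [reflexivity|]. split.
  - intros n k x Hk. apply (scheme_increment _ k (cond_pos (RinvN n)) x i Hk).
  - intros n k x y Hk. apply (scheme_space_increment _ k (cond_pos (RinvN n)) x y i Hk).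
Qed.

Lemma filterlim_scheme (t x : R) (i : I) : 0 <= t <= delta ->
  let w n := scheme (RinvN n) (step_index n t) x i in
  filterlim (fun n => jval (w n)) U (locally (jval (limit_jet t x i))) /\
  filterlim (fun n => jder1 (w n)) U (locally (jder1 (limit_jet t x i))) /\
  filterlim (fun n => jder2 (w n)) U (locally (jder2 (limit_jet t x i))).
Proof.
  intros Ht w. split; [|split].
  - exact (filterlim_grid_limit U (scheme_val_grid i) t x Ht).
  - exact (filterlim_grid_limit U (scheme_der_grid i) t x Ht).
  - apply (filterlim_ulim U _ (der_bound i)). intros n.
    apply scheme_der_bound; [apply cond_pos|apply (step_index_le_delta delta), Ht].
Qed.

Lemma limit_jet_near (t x : R) : 0 <= t <= delta -> near t x (limit_jet t x).
Proof.
  intros Ht i. set (time := fun n => INR (step_index n t) * RinvN n).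
  assert (Htime : filterlim time U (locally t)) by (apply (filterlim_step_time U); lra).
  destruct (filterlim_scheme t x i Ht) as (Hval & Hder1 & Hder2).
  apply (jnorm_limit_le U
    (fun n => scheme (RinvN n) (step_index n t) x i - (base x i + jconst (time n) * slope x i))%J
    _ (fun n => M i * time n ^ 2)); simpl.
  5: { apply filter_forall. intros n.
       apply (scheme_near_holonomic _ _ (cond_pos (RinvN n))), step_index_le_delta, Ht. }
  all: repeat first [exact Hval|exact Hder1|exact Hder2|exact Htime|apply filterlim_const
    |apply filterlim_Rplus|apply filterlim_Ropp|apply filterlim_Rmult].
Qed.

Definition limit_dt (i : I) (t x : R) : R :=
  if Req_EM_T t 0 then jval (slope x i) else rate i (limit_jet t x).

Lemma limit_dt_pos (i : I) (t x : R) : 0 < t -> limit_dt i t x = rate i (limit_jet t x).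
Proof. intros Ht. unfold limit_dt. destruct (Req_EM_T t 0); [lra|reflexivity]. Qed.

Lemma limit_dt_0 (i : I) (x : R) : limit_dt i 0 x = jval (slope x i).
Proof. unfold limit_dt. destruct (Req_EM_T 0 0); [reflexivity|lra]. Qed.

Lemma limit_jet_0 (i : I) (x : R) : jval (limit_jet 0 x i) = jval (base x i).
Proof. apply (grid_limit_0 U (scheme_val_grid i)). lra. Qed.

Lemma filterlim_rate {T : Type} (F : (T -> Prop) -> Prop) {HF : Filter F} (i : I)
    (w : T -> I -> jet) (l : I -> jet) :
  domain (fun j => jval (l j)) -> (forall j, filterlim (fun q => jval (w q j)) F (locally (jval (l j)))) ->
  filterlim (fun q => jder1 (w q i)) F (locally (jder1 (l i))) ->
  filterlim (fun q => rate i (w q)) F (locally (rate i l)).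
Proof.
  intros Hl Hval Hder.
  apply filterlim_Rplus; [apply filterlim_Rmult; [|exact Hder]|];
    [apply speed_operator|apply source_operator]; assumption.
Qed.

Lemma limit_jet_cont (i : I) :
  cont_strip delta (fun t x => jval (limit_jet t x i)) /\ cont_strip delta (fun t x => jder1 (limit_jet t x i)).
Proof.
  split; [exact (grid_limit_cont U (scheme_val_grid i))|exact (grid_limit_cont U (scheme_der_grid i))].
Qed.

Lemma limit_jet_pderiv_x (i : I) :
  pderiv_x delta (fun t x => jval (limit_jet t x i)) (fun t x => jder1 (limit_jet t x i)).
Proof.
  apply (grid_limit_pderiv_x U (scheme_val_grid i) (scheme_der_grid i)).
  intros n k x d Hk. exact (scheme_taylor _ k (cond_pos (RinvN n)) x d i Hk).
Qed.

Lemma filterlim_scheme_rate (i : I) (t x : R) : 0 < t <= delta ->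
  filterlim (fun q => rate i (scheme (RinvN (fst q)) (step_index (fst q) (snd q)) x))
    (filter_prod U (within (fun s => 0 <= s <= delta) (locally t))) (locally (rate i (limit_jet t x))).
Proof.
  intros Ht. assert (Ht0 : 0 <= t <= delta) by lra. apply (filterlim_rate (filter_prod _ _)).
  - exact (near_domain t x _ Ht (limit_jet_near t x Ht0)).
  - intros j. exact (filterlim_grid_limit_joint U (scheme_val_grid j) t x Ht0).
  - exact (filterlim_grid_limit_joint U (scheme_der_grid i) t x Ht0).
Qed.

Lemma limit_jet_pderiv_t (i : I) : pderiv_t delta (fun t x => jval (limit_jet t x i)) (limit_dt i).
Proof.
  intros t x Ht eps He. destruct (Req_dec t 0) as [->|Hn].
  - pose proof (M_ge0 i) as HM. exists (eps / (M i + 1)). split; [apply Rdiv_lt_0_compat; lra|].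
    intros h Hh Hhd Hth. rewrite Rplus_0_l in *. rewrite limit_dt_0, limit_jet_0.
    replace ((jval (limit_jet h x i) - jval (base x i)) / h - jval (slope x i))
      with ((jval (limit_jet h x i) - (jval (base x i) + h * jval (slope x i))) / h) by (field; exact Hh).
    apply Rabs_div_lt; [exact Hh|].
    apply Rle_lt_trans with (M i * h ^ 2); [|apply quadratic_lt_linear; assumption].
    exact (Rle_trans _ _ _ (Rabs_jval_le _) (limit_jet_near h x Hth i)).
  - assert (Ht' : 0 < t <= delta) by lra. rewrite limit_dt_pos by lra.
    apply (grid_limit_derive_t U (scheme_val_grid i) (fun n k y => rate i (scheme (RinvN n) k y))); try assumption.
    + intros n k y Hk Hkd. exact (proj2 (proj2 (scheme_increment _ k (cond_pos (RinvN n)) y i Hkd)) Hk).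
    + exact (filterlim_scheme_rate i t x Ht').
Qed.

Lemma limit_dt_sub_slope (i : I) (t x : R) : 0 <= t <= delta ->
  Rabs (limit_dt i t x - jval (slope x i)) <= (sigma i * der_bound i + tau i) * t.
Proof.
  intros Ht. destruct (Req_dec t 0) as [->|Hn]; [rewrite limit_dt_0, Rminus_diag, Rabs_R0; lra|].
  assert (Ht' : 0 < t <= delta) by lra. pose proof (limit_jet_near t x Ht) as Hnear.
  rewrite limit_dt_pos by lra. unfold rate, Rminus. rewrite Rplus_assoc.
  replace ((sigma i * der_bound i + tau i) * t) with (sigma i * t * der_bound i + tau i * t) by ring.
  apply Rabs_plus_le.
  - apply Rabs_mult_le; [|apply (near_der_bound t x); assumption].
    exact (Rle_trans _ _ _ (Rabs_jval_le _) (speed_near t x _ i Ht' Hnear)).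
  - exact (Rle_trans _ _ _ (Rabs_jval_le _) (source_near t x _ i Ht' Hnear)).
Qed.

Lemma limit_dt_cont_0 (i : I) (x eps : R) : 0 < eps -> exists d, 0 < d /\
  forall t' x', 0 <= t' <= delta -> Rabs (t' - 0) < d -> Rabs (x' - x) < d ->
    Rabs (limit_dt i t' x' - limit_dt i 0 x) < eps.
Proof.
  intros He. set (C := sigma i * der_bound i + tau i).
  assert (HC : 0 <= C).
  { apply Rplus_le_le_0_compat; [apply Rmult_le_pos; [apply sigma_ge0|apply der_bound_le]|apply tau_ge0]. }
  assert (Hcont : continuous (fun y => jval (slope y i)) x).
  { apply @ex_derive_continuous. exists (jder1 (slope x i)). apply slope_holonomic. }
  destruct (proj1 (filterlim_locally_R _ _) Hcont (eps / 2) ltac:(lra)) as [d Hd].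
  set (e := eps / 2 / (C + 1)). assert (He' : 0 < e) by (repeat apply Rdiv_lt_0_compat; lra).
  exists (Rmin d e). split; [apply Rmin_glb_lt; [apply cond_pos|exact He']|]. intros t' x' Ht' Htt Hxx.
  pose proof (Rmin_l d e). pose proof (Rmin_r d e). rewrite Rminus_0_r, Rabs_pos_eq in Htt by lra.
  assert (Hx : Rabs (jval (slope x' i) - jval (slope x i)) < eps / 2).
  { apply Hd. apply Rlt_le_trans with (Rmin d e); assumption. }
  assert (Ht : C * t' <= C * e) by (apply Rmult_le_compat_l; lra).
  assert (Ee : (C + 1) * e = eps / 2) by (unfold e; field; lra).
  rewrite limit_dt_0.
  replace (limit_dt i t' x' - jval (slope x i))
    with ((limit_dt i t' x' - jval (slope x' i)) + (jval (slope x' i) - jval (slope x i))) by ring.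
  pose proof (limit_dt_sub_slope i t' x' Ht') as Hr. fold C in Hr.
  eapply Rle_lt_trans; [apply Rabs_triang|]. lra.
Qed.

Lemma limit_dt_cont (i : I) : cont_strip delta (limit_dt i).
Proof.
  intros t x Ht. destruct (Req_dec t 0) as [->|Hn]; [intros eps He; apply limit_dt_cont_0, He|].
  assert (Ht' : 0 < t <= delta) by lra. apply filterlim_strip_at. rewrite limit_dt_pos by lra.
  apply (filterlim_ext_loc (fun q => rate i (limit_jet (fst q) (snd q)))).
  - apply (Filter_prod _ _ _ (fun s => 0 < s) (fun _ => True)); [|apply filter_true|].
    + exists (mkposreal t (proj1 Ht')). intros s Hs _.
      assert (Hst : Rabs (s - t) < t) by exact Hs. apply Rabs_def2 in Hst. lra.
    + intros s y Hs _. rewrite limit_dt_pos by exact Hs. reflexivity.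
  - apply (filterlim_rate (strip_at delta t x)).
    + exact (near_domain t x _ Ht' (limit_jet_near t x Ht)).
    + intros j. apply (filterlim_strip_at delta (fun s y => jval (limit_jet s y j))).
      exact (proj1 (limit_jet_cont j) t x Ht).
    + apply (filterlim_strip_at delta (fun s y => jder1 (limit_jet s y i))).
      exact (proj2 (limit_jet_cont i) t x Ht).
Qed.

End Convergence.

Theorem singular_cauchy_problem_solvable :
  exists (W : R -> R -> I -> jet) (Wt : I -> R -> R -> R),
    (forall i, C1_strip delta (fun t x => jval (W t x i)) (Wt i) (fun t x => jder1 (W t x i))) /\
    (forall t x, 0 < t <= delta -> near t x (W t x) /\ forall i, Wt i t x = rate i (W t x)) /\
    (forall x i, jval (W 0 x i) = jval (base x i) /\ Wt i 0 x = jval (slope x i)).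
Proof.
  destruct FreeUltrafilter_exists as [U HU]. exists (limit_jet U), (limit_dt U). split; [|split].
  - intros i. destruct (limit_jet_cont U i) as [Hcont Hcontx].
    pose proof (limit_jet_pderiv_t U i). pose proof (limit_jet_pderiv_x U i). pose proof (limit_dt_cont U i).
    unfold C1_strip. tauto.
  - intros t x Ht. split; [apply (limit_jet_near U); lra|]. intros i. apply limit_dt_pos, Ht.
  - intros x i. split; [apply (limit_jet_0 U)|apply limit_dt_0].
Qed.

End SingularCauchyProblem.

(** * Asymptotic expansions of families of jets *)

Definition small {X : Type} (dom : X -> Prop) (scale : X -> R) (p : X) : Prop := dom p /\ 0 < scale p <= 1.

Definition bigO {X : Type} (dom : X -> Prop) (scale : X -> R) (k : nat) (f : X -> jet) : Prop :=
  exists K, 0 <= K /\ forall p, small dom scale p -> jnorm (f p) <= K * scale p ^ k.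

Definition leading_part {X : Type} (dom : X -> Prop) (scale : X -> R) (f F : X -> jet) : Prop :=
  bigO dom scale 0 F /\ bigO dom scale 1 (fun p => f p - F p)%J.

Section BigO.
Context {X : Type} {dom : X -> Prop} {scale : X -> R}.
Local Notation small := (small dom scale).
Local Notation bigO := (bigO dom scale).
Local Notation leading_part := (leading_part dom scale).

Lemma bigO_ext {k : nat} (f : X -> jet) {g : X -> jet} : (forall p, small p -> f p = g p) -> bigO k f -> bigO k g.
Proof.
  intros E (K & HK & H). exists K. split; [exact HK|]. intros p Hp. rewrite <- E by exact Hp. apply H, Hp.
Qed.

Lemma bigO_add {k : nat} {f g : X -> jet} : bigO k f -> bigO k g -> bigO k (fun p => f p + g p)%J.
Proof.
  intros (K & HK & Hf) (L & HL & Hg). exists (K + L). split; [lra|]. intros p Hp.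
  rewrite Rmult_plus_distr_r. apply jnorm_add_le; auto.
Qed.

Lemma bigO_opp {k : nat} {f : X -> jet} : bigO k f -> bigO k (fun p => - f p)%J.
Proof. intros (K & HK & Hf). exists K. split; [exact HK|]. intros p Hp. rewrite jnorm_opp. auto. Qed.

Lemma bigO_sub {k : nat} {f g : X -> jet} : bigO k f -> bigO k g -> bigO k (fun p => f p - g p)%J.
Proof. intros Hf Hg. apply bigO_add, bigO_opp; assumption. Qed.

Lemma bigO_mul (k l : nat) {f g : X -> jet} : bigO k f -> bigO l g -> bigO (k + l) (fun p => f p * g p)%J.
Proof.
  intros (K & HK & Hf) (L & HL & Hg). exists (K * L). split; [apply Rmult_le_pos; assumption|]. intros p Hp.
  replace (K * L * scale p ^ (k + l)) with (K * scale p ^ k * (L * scale p ^ l)) by (rewrite pow_add; ring).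
  apply jnorm_mul_le; auto.
Qed.

Lemma bigO_mul_bounded {k : nat} {f g : X -> jet} : bigO 0 f -> bigO k g -> bigO k (fun p => f p * g p)%J.
Proof. apply (bigO_mul 0). Qed.

Lemma bigO_weaken (k : nat) {l : nat} {f : X -> jet} : (l <= k)%nat -> bigO k f -> bigO l f.
Proof.
  intros Hl (K & HK & Hf). exists K. split; [exact HK|]. intros p Hp.
  eapply Rle_trans; [apply Hf, Hp|]. apply Rmult_le_compat_l; [exact HK|].
  destruct Hp as [_ Hp]. replace k with (l + (k - l))%nat by lia. rewrite pow_add, <- Rmult_1_r.
  apply Rmult_le_compat_l; [apply pow_le; lra|]. rewrite <- (pow1 (k - l)). apply pow_incr. lra.
Qed.

Lemma bigO_bounded_scalar (c : X -> R) (B : R) :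
  (forall p, small p -> Rabs (c p) <= B) -> bigO 0 (fun p => jconst (c p)).
Proof.
  intros Hc. exists (Rmax B 0). split; [apply Rmax_r|]. intros p Hp. rewrite jnorm_const. simpl. rewrite Rmult_1_r.
  exact (Rle_trans _ _ _ (Hc p Hp) (Rmax_l B 0)).
Qed.

Lemma bigO_const (r : R) : bigO 0 (fun _ => jconst r).
Proof. apply (bigO_bounded_scalar (fun _ => r) (Rabs r)). intros; apply Rle_refl. Qed.

Lemma bigO_scale_mul {k : nat} {f : X -> jet} : bigO k f -> bigO (S k) (fun p => jconst (scale p) * f p)%J.
Proof.
  apply (bigO_mul 1). exists 1. split; [lra|]. intros p [_ Hp]. rewrite jnorm_const, Rabs_pos_eq; simpl; lra.
Qed.

Lemma bigO_scale_div {k : nat} {f : X -> jet} : bigO (S k) f -> bigO k (fun p => jconst (/ scale p) * f p)%J.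
Proof.
  intros (K & HK & Hf). exists K. split; [exact HK|]. intros p Hp.
  replace (K * scale p ^ k) with (/ scale p * (K * scale p ^ S k)) by (simpl; field; destruct Hp; lra).
  apply jnorm_scale_le; [|apply Hf, Hp]. left. apply Rinv_0_lt_compat, Hp.
Qed.

Lemma bigO_inv (k : nat) {m : R} {f : X -> jet} : 0 < m ->
  (forall p, small p -> m * scale p ^ k <= Rabs (jval (f p))) -> bigO k f ->
  bigO 0 (fun p => jconst (scale p ^ k) * / f p)%J.
Proof.
  intros Hm Hlow (K & HK & Hf). assert (Hi : 0 < / m) by (apply Rinv_0_lt_compat, Hm).
  exists (/ m + / m * / m * K + / m * / m * / m * K ^ 2). split.
  - assert (0 <= K ^ 2) by (apply pow_le, HK). repeat apply Rplus_le_le_0_compat; repeat apply Rmult_le_pos; lra.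
  - intros p Hp. assert (Hs : 0 < scale p ^ k) by (apply pow_lt, Hp). rewrite pow_O, Rmult_1_r.
    eapply Rle_trans.
    + apply jnorm_scale_le; [lra|].
      apply (jnorm_inv_le _ (m * scale p ^ k) (K * scale p ^ k)); auto using Rmult_lt_0_compat.
    + right. field. split; lra.
Qed.

Lemma leading_bounded {f F : X -> jet} : leading_part f F -> bigO 0 f.
Proof.
  intros [HF Hf]. apply (bigO_ext (fun p => F p + (f p - F p))%J); [intros; ring|].
  apply bigO_add; [exact HF|]. exact (bigO_weaken 1 (Nat.le_0_l 1) Hf).
Qed.

Lemma leading_refl {f : X -> jet} : bigO 0 f -> leading_part f f.
Proof.
  intros Hf. split; [exact Hf|]. apply (bigO_ext (fun _ => 0%J)); [intros; ring|].
  exists 0. split; [lra|]. intros. rewrite jnorm_0. lra.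
Qed.

Lemma leading_const (r : R) : leading_part (fun _ => jconst r) (fun _ => jconst r).
Proof. apply leading_refl, bigO_const. Qed.

Lemma leading_add {f F g G : X -> jet} : leading_part f F -> leading_part g G ->
  leading_part (fun p => f p + g p)%J (fun p => F p + G p)%J.
Proof.
  intros [HF Hf] [HG Hg]. split; [apply bigO_add; assumption|].
  apply (bigO_ext (fun p => (f p - F p) + (g p - G p))%J); [intros; ring|]. apply bigO_add; assumption.
Qed.

Lemma leading_opp {f F : X -> jet} : leading_part f F -> leading_part (fun p => - f p)%J (fun p => - F p)%J.
Proof.
  intros [HF Hf]. split; [apply bigO_opp, HF|].
  apply (bigO_ext (fun p => - (f p - F p))%J); [intros; ring|]. apply bigO_opp, Hf.
Qed.

Lemma leading_mul {f F g G : X -> jet} : leading_part f F -> leading_part g G ->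
  leading_part (fun p => f p * g p)%J (fun p => F p * G p)%J.
Proof.
  intros Hf Hg. pose proof (leading_bounded Hg) as Hg0. destruct Hf as [HF Hf], Hg as [HG Hg].
  split; [apply bigO_mul_bounded; assumption|].
  apply (bigO_ext (fun p => (f p - F p) * g p + F p * (g p - G p))%J); [intros; ring|].
  apply bigO_add; [exact (bigO_mul 1 0 Hf Hg0)|apply bigO_mul_bounded; assumption].
Qed.

Lemma leading_add_small {f F g : X -> jet} :
  leading_part f F -> bigO 1 g -> leading_part (fun p => f p + g p)%J F.
Proof.
  intros [HF Hf] Hg. split; [exact HF|].
  apply (bigO_ext (fun p => (f p - F p) + g p)%J); [intros; ring|]. apply bigO_add; assumption.
Qed.

Lemma leading_ext {f F g G : X -> jet} : (forall p, small p -> f p = g p) -> (forall p, small p -> F p = G p) ->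
  leading_part f F -> leading_part g G.
Proof.
  intros Ef EF [HF Hf]. split; [exact (bigO_ext F EF HF)|].
  revert Hf. apply bigO_ext. intros p Hp. rewrite Ef, EF by exact Hp. reflexivity.
Qed.

Lemma leading_inv {f : X -> jet} {r m : R} : 0 < m -> m <= Rabs r ->
  (forall p, small p -> m <= Rabs (jval (f p))) ->
  leading_part f (fun _ => jconst r) -> leading_part (fun p => / f p)%J (fun _ => jconst (/ r)).
Proof.
  intros Hm Hr Hlow Hf. pose proof (leading_bounded Hf) as Hf0. split; [apply bigO_const|].
  assert (Hr0 : r <> 0) by (intros ->; rewrite Rabs_R0 in Hr; lra).
  assert (Hi : bigO 0 (fun p => / f p)%J).
  { apply (bigO_ext (fun p => jconst (scale p ^ 0) * / f p)%J); [intros; simpl; ring|].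
    apply (bigO_inv 0 Hm); [|exact Hf0]. intros p Hp. simpl. rewrite Rmult_1_r. auto. }
  apply (bigO_ext (fun p => - ((/ f p * jconst (/ r)) * (f p - jconst r)))%J).
  - intros p Hp. assert (Hf_inv : (f p * / f p = 1)%J).
    { apply jmul_inv. intros Ez. specialize (Hlow p Hp). rewrite Ez, Rabs_R0 in Hlow. lra. }
    assert (Hr_inv : (jconst r * jconst (/ r) = 1)%J) by (rewrite <- jconst_mul, Rinv_r by exact Hr0; reflexivity).
    transitivity (/ f p * (jconst r * jconst (/ r)) - (f p * / f p) * jconst (/ r))%J; [ring|].
    rewrite Hf_inv, Hr_inv. ring.
  - apply bigO_opp, bigO_mul_bounded; [|apply Hf]. apply bigO_mul_bounded; [exact Hi|apply bigO_const].
Qed.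

Lemma leading_comp {D : nat -> R -> R} {n : nat} {z : R} {u : X -> jet} : derivative_sequence D ->
  (forall k : nat, (1 + n <= k <= 2 + n)%nat -> bounded_fun (D k)) -> bigO 1 (fun p => u p - jconst z)%J ->
  leading_part (fun p => jcomp (jet_of D n) (u p)) (fun _ => jconst (D n z)).
Proof.
  intros HD HB (K & HK & Hu). split; [apply bigO_const|].
  destruct (bounded_fun_common_bound D _ _ HB) as (B & HB0 & HB').
  exists (B * (K + K ^ 2)). split; [apply Rmult_le_pos; [exact HB0|]; pose proof (pow_le K 2 HK); lra|].
  intros p Hp. eapply Rle_trans; [apply (jnorm_comp_sub_value D n B z (u p) HD HB')|].
  rewrite Rmult_assoc. apply Rmult_le_compat_l; [exact HB0|].
  specialize (Hu p Hp). rewrite pow_1 in Hu |- *. pose proof (jnorm_ge0 (u p - jconst z)) as HN.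
  destruct Hp as [_ Hp]. set (N := jnorm (u p - jconst z)) in *.
  assert (N ^ 2 <= (K * scale p) ^ 2) by (apply pow_incr; lra).
  assert (K ^ 2 * (scale p * scale p) <= K ^ 2 * (scale p * 1)).
  { apply Rmult_le_compat_l; [apply pow_le, HK|]. apply Rmult_le_compat_l; lra. }
  simpl in *. lra.
Qed.

Lemma bigO_comp_taylor {D : nat -> R -> R} {n : nat} {z : R} {u : X -> jet} : derivative_sequence D ->
  (forall k : nat, (2 + n <= k <= 3 + n)%nat -> bounded_fun (D k)) -> bigO 1 (fun p => u p - jconst z)%J ->
  bigO 2 (fun p => jcomp (jet_of D n) (u p) - jconst (D n z) - jcomp (jet_of D (S n)) (u p) * (u p - jconst z))%J.
Proof.
  intros HD HB (K & HK & Hu).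
  destruct (bounded_fun_common_bound D _ _ HB) as (B & HB0 & HB').
  exists (B * (K ^ 2 + K ^ 3)). split.
  { apply Rmult_le_pos; [exact HB0|]. pose proof (pow_le K 2 HK). pose proof (pow_le K 3 HK). lra. }
  intros p Hp. eapply Rle_trans; [apply (jnorm_comp_taylor D n B z (u p) HD HB')|].
  rewrite Rmult_assoc. apply Rmult_le_compat_l; [exact HB0|].
  specialize (Hu p Hp). rewrite pow_1 in Hu. pose proof (jnorm_ge0 (u p - jconst z)) as HN.
  destruct Hp as [_ Hp]. set (N := jnorm (u p - jconst z)) in *.
  assert (N ^ 2 <= (K * scale p) ^ 2) by (apply pow_incr; lra).
  assert (N ^ 3 <= (K * scale p) ^ 3) by (apply pow_incr; lra).
  assert (K ^ 3 * scale p ^ 2 * scale p <= K ^ 3 * scale p ^ 2 * 1).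
  { apply Rmult_le_compat_l; [apply Rmult_le_pos; apply pow_le; lra|lra]. }
  rewrite Rpow_mult_distr in *. simpl in *. lra.
Qed.

End BigO.

(** * The variational wave system *)

Inductive component := cU | cV | cR1 | cS1 | cR2 | cS2.

Definition riemann (i : component) : bool := match i with cU | cV => false | _ => true end.

Lemma component_common_bound (P : component -> R -> Prop) (b : R) :
  (forall i x y, x <= y -> P i x -> P i y) -> (forall i, exists x, P i x) ->
  exists x, b <= x /\ forall i, P i x.
Proof.
  intros Hmono Hex.
  destruct (Hex cU) as [xU HU], (Hex cV) as [xV HV], (Hex cR1) as [xR1 HR1],
    (Hex cS1) as [xS1 HS1], (Hex cR2) as [xR2 HR2], (Hex cS2) as [xS2 HS2].
  exists (MaxRlist (b :: xU :: xV :: xR1 :: xS1 :: xR2 :: xS2 :: nil)%list).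
  split; [apply MaxRlist_P1; simpl; tauto|].
  intros []; [revert HU|revert HV|revert HR1|revert HS1|revert HR2|revert HS2];
    apply Hmono, MaxRlist_P1; simpl; tauto.
Qed.

Section WaveSystem.
Variables (Dc Da Dphi2 Dpsi1 Dpsi2 : nat -> R -> R) (m0 psi0 phi1 : R).

Definition jpsi1 : R -> jet := jet_of Dpsi1 0.
Definition jpsi2 : R -> jet := jet_of Dpsi2 0.
Definition jdphi2 : R -> jet := jet_of Dphi2 1.

Definition slope1 (lam x : R) : jet :=
  (jconst (Da 0%nat phi1 * Da 1%nat phi1) * (jpsi2 x * jpsi2 x)
   + jconst lam * (jconst (2 * (Da 0%nat phi1 * Da 1%nat phi1)) * jdphi2 x))%J.
Definition slope2_odd (x : R) : jet := (jconst (Dc 1%nat phi1) * (jpsi1 x * jdphi2 x))%J.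
Definition slope2_even (x : R) : jet :=
  (jconst (2 * (Da 1%nat phi1 * / Da 0%nat phi1)) * (jpsi1 x * jpsi2 x))%J.

Definition base (x : R) (i : component) : jet :=
  match i with
  | cU => jconst phi1 | cV => jet_of Dphi2 0 x
  | cR1 | cS1 => jpsi1 x | cR2 | cS2 => jpsi2 x
  end.

Definition slope (lam x : R) (i : component) : jet :=
  match i with
  | cU => jpsi1 x | cV => jpsi2 x | cR1 | cS1 => slope1 lam x
  | cR2 => (slope2_odd x - slope2_even x)%J | cS2 => (- slope2_odd x - slope2_even x)%J
  end.

Definition jc (w : component -> jet) : jet := jcomp (jet_of Dc 0) (w cU).
Definition jdc (w : component -> jet) : jet := jcomp (jet_of Dc 1) (w cU).
Definition ja (w : component -> jet) : jet := jcomp (jet_of Da 0) (w cU).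
Definition jda (w : component -> jet) : jet := jcomp (jet_of Da 1) (w cU).

Definition speed (i : component) (w : component -> jet) : jet :=
  match i with
  | cU | cV => 0%J | cR1 | cR2 => jc w | cS1 | cS2 => (- jc w)%J
  end.

Definition skew_source (r d : jet) (w : component -> jet) : jet := (jdc w * r * (half d * / jc w))%J.
Definition common_source1 (lam : R) (w : component -> jet) : jet :=
  (jconst lam * (jconst 2 * (ja w * jda w)) * (half (w cR2 - w cS2) * / jc w)
   - ja w * ja w * jdc w * (half (w cR2 - w cS2) * (half (w cR2 - w cS2) * / jc w))
   + ja w * jda w * (w cR2 * w cS2))%J.
Definition common_source2 (lam : R) (w : component -> jet) : jet :=
  (- (jconst lam * (jconst 2 * (jda w * / ja w)) * (half (w cR1 - w cS1) * / jc w))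
   - jda w * / ja w * (w cR1 * w cS2 + w cS1 * w cR2))%J.

Definition source (lam : R) (i : component) (w : component -> jet) : jet :=
  match i with
  | cU => half (w cR1 + w cS1)
  | cV => half (w cR2 + w cS2)
  | cR1 => (skew_source (half (w cR1 + w cS1)) (w cR1 - w cS1) w + common_source1 lam w)%J
  | cS1 => (- skew_source (half (w cR1 + w cS1)) (w cR1 - w cS1) w + common_source1 lam w)%J
  | cR2 => (skew_source (w cR1) (w cR2 - w cS2) w + common_source2 lam w)%J
  | cS2 => (- skew_source (w cS1) (w cR2 - w cS2) w + common_source2 lam w)%J
  end.

Hypothesis Dc_derivatives : derivative_sequence Dc.
Hypothesis Da_derivatives : derivative_sequence Da.
Hypothesis Dphi2_derivatives : derivative_sequence Dphi2.
Hypothesis Dpsi1_derivatives : derivative_sequence Dpsi1.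
Hypothesis Dpsi2_derivatives : derivative_sequence Dpsi2.
Hypothesis Dc_bounded : forall l : nat, (1 <= l <= 3)%nat -> bounded_fun (Dc l).
Hypothesis Da_bounded : forall l : nat, (1 <= l <= 3)%nat -> bounded_fun (Da l).
Hypothesis Dphi2_bounded : forall j : nat, (1 <= j <= 4)%nat -> bounded_fun (Dphi2 j).
Hypothesis Dpsi1_bounded : forall k : nat, (k <= 3)%nat -> bounded_fun (Dpsi1 k).
Hypothesis Dpsi2_bounded : forall k : nat, (k <= 3)%nat -> bounded_fun (Dpsi2 k).
Hypothesis m0_pos : 0 < m0.
Hypothesis dc_lower : forall z, Rabs (Dc 1%nat z) >= m0.
Hypothesis a_lower : forall z, Rabs (Da 0%nat z) >= m0.
Hypothesis c_phi1 : Dc 0%nat phi1 = 0.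
Hypothesis psi0_pos : 0 < psi0.
Hypothesis psi1_lower : forall x, Rabs (Dpsi1 0%nat x) >= psi0.

Lemma a_neq0 (z : R) : Da 0%nat z <> 0.
Proof. intros E. specialize (a_lower z). rewrite E, Rabs_R0 in a_lower. lra. Qed.

Lemma jpsi1_stable : exists L, jshift_stable jpsi1 L.
Proof. apply jshift_stable_jet_of; [exact Dpsi1_derivatives|]. intros; apply Dpsi1_bounded; lia. Qed.

Lemma jpsi2_stable : exists L, jshift_stable jpsi2 L.
Proof. apply jshift_stable_jet_of; [exact Dpsi2_derivatives|]. intros; apply Dpsi2_bounded; lia. Qed.

Lemma jdphi2_stable : exists L, jshift_stable jdphi2 L.
Proof. apply jshift_stable_jet_of; [exact Dphi2_derivatives|]. intros; apply Dphi2_bounded; lia. Qed.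

Lemma base_lipschitz (i : component) : exists L, jshift_lipschitz (fun x => base x i) L.
Proof.
  destruct jpsi1_stable as (L1 & _ & Hpsi1), jpsi2_stable as (L2 & _ & Hpsi2).
  destruct i; [exists 0; apply jshift_lipschitz_const| |exists L1|exists L1|exists L2|exists L2]; try assumption.
  apply jshift_lipschitz_jet_of; [exact Dphi2_derivatives|]. intros; apply Dphi2_bounded; lia.
Qed.

Lemma slope_stable (i : component) :
  exists L, forall lam, Rabs lam <= 1 -> jshift_stable (fun x => slope lam x i) L.
Proof.
  destruct jpsi1_stable as [L1 Hpsi1], jpsi2_stable as [L2 Hpsi2], jdphi2_stable as [L3 Hdphi2].
  assert (Hodd := jshift_stable_scale (Dc 1%nat phi1) (jshift_stable_mul Hpsi1 Hdphi2)).
  assert (Heven := jshift_stable_opp (jshift_stable_scale (2 * (Da 1%nat phi1 * / Da 0%nat phi1))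
    (jshift_stable_mul Hpsi1 Hpsi2))).
  assert (Hslope1 : exists L, forall lam, Rabs lam <= 1 -> jshift_stable (slope1 lam) L).
  { eexists. intros lam Hlam. eapply jshift_stable_add.
    - exact (jshift_stable_scale _ (jshift_stable_mul Hpsi2 Hpsi2)).
    - exact (jshift_stable_scale_le1 Hlam (jshift_stable_scale _ Hdphi2)). }
  destruct i; simpl; [exists L1; auto|exists L2; auto|exact Hslope1|exact Hslope1| |]; eexists; intros _ _.
  - exact (jshift_stable_add Hodd Heven).
  - exact (jshift_stable_add (jshift_stable_opp Hodd) Heven).
Qed.

Lemma base_slope_bound : exists A, 1 <= A /\ forall i,
  jshift_lipschitz (fun x => base x i) A /\
  forall lam, Rabs lam <= 1 -> jshift_stable (fun x => slope lam x i) A.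
Proof.
  apply component_common_bound.
  - intros i x y Hxy [Hb Hs]. split; [exact (jshift_lipschitz_weaken Hxy Hb)|].
    intros lam Hlam. exact (jshift_stable_weaken Hxy (Hs lam Hlam)).
  - intros i. destruct (base_lipschitz i) as [L HL], (slope_stable i) as [M HM]. exists (Rmax L M).
    split; [exact (jshift_lipschitz_weaken (Rmax_l L M) HL)|].
    intros lam Hlam. exact (jshift_stable_weaken (Rmax_r L M) (HM lam Hlam)).
Qed.

Definition c_nonzero (l : component -> R) : Prop := Dc 0%nat (l cU) <> 0.

Lemma base_holonomic (i : component) : holonomic (fun x => base x i).
Proof. destruct i; first [apply holonomic_jet_of; assumption|intros x; apply holonomic_const]. Qed.

Lemma slope_holonomic (lam : R) (i : component) : holonomic (fun x => slope lam x i).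
Proof.
  intros x. pose proof (holonomic_jet_of Dpsi1 0 Dpsi1_derivatives x).
  pose proof (holonomic_jet_of Dpsi2 0 Dpsi2_derivatives x).
  pose proof (holonomic_jet_of Dphi2 1 Dphi2_derivatives x).
  destruct i; simpl; unfold slope1, slope2_odd, slope2_even;
    repeat first [assumption|apply holonomic_const|apply holonomic_sub|apply holonomic_add|apply holonomic_opp
      |apply holonomic_mul].
Qed.

Lemma coefficient_operator (D : nat -> R -> R) (n : nat) : derivative_sequence D ->
  jet_operator_on component c_nonzero (fun w => jcomp (jet_of D n) (w cU)).
Proof. intros HD. apply jet_operator_comp; [apply holonomic_jet_of, HD|apply jet_operator_coord]. Qed.

Lemma speed_operator (i : component) : jet_operator_on component c_nonzero (speed i).
Proof.
  assert (jet_operator_on component c_nonzero jc) by (apply coefficient_operator, Dc_derivatives).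
  destruct i; simpl; first [assumption|apply jet_operator_const|apply jet_operator_opp; assumption].
Qed.

Lemma source_operator (lam : R) (i : component) : jet_operator_on component c_nonzero (source lam i).
Proof.
  assert (Hc : jet_operator_on component c_nonzero jc) by (apply coefficient_operator, Dc_derivatives).
  assert (Ha : jet_operator_on component c_nonzero ja) by (apply coefficient_operator, Da_derivatives).
  assert (Hdc : jet_operator_on component c_nonzero jdc) by (apply coefficient_operator, Dc_derivatives).
  assert (Hda : jet_operator_on component c_nonzero jda) by (apply coefficient_operator, Da_derivatives).
  assert (Hcinv : jet_operator_on component c_nonzero (fun w => / jc w)%J).
  { apply jet_operator_inv; [|exact Hc]. intros w Hw. exact Hw. }
  assert (Hainv : jet_operator_on component c_nonzero (fun w => / ja w)%J).
  { apply jet_operator_inv; [|exact Ha]. intros w _. apply a_neq0. }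
  destruct i; unfold source, skew_source, common_source1, common_source2, half;
    repeat first [assumption|apply jet_operator_const|apply jet_operator_coord|apply jet_operator_sub
      |apply jet_operator_add|apply jet_operator_opp|apply jet_operator_mul].
Qed.

Record point := Point { time : R; coupling : R; position : R; state : component -> jet }.

Definition remainder (p : point) (i : component) : jet :=
  (state p i - (base (position p) i + jconst (time p) * slope (coupling p) (position p) i))%J.

Section Expansions.
Variables A delta0 : R.
Hypothesis A_ge1 : 1 <= A.
Hypothesis base_slope_A : forall i, jshift_lipschitz (fun x => base x i) A /\
  forall lam, Rabs lam <= 1 -> jshift_stable (fun x => slope lam x i) A.
Hypothesis delta0_range : 0 < delta0 <= 1.
Hypothesis delta0_small : 2 * A * delta0 <= psi0 / 2.

Definition admissible (p : point) : Prop :=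
  0 < time p <= delta0 /\ Rabs (coupling p) <= 1 /\
  jnorm (remainder p cU) <= 2 * A * time p ^ 2 /\ forall i, riemann i = true -> jnorm (remainder p i) <= time p.

Local Notation O := (bigO admissible time).
Local Notation leads := (leading_part admissible time).

Lemma admissible_small (p : point) : admissible p -> small admissible time p.
Proof. intros Hp. split; [exact Hp|]. destruct Hp as [Ht _]. lra. Qed.

Lemma bigO_remainder (i : component) : riemann i = true -> O 1 (fun p => remainder p i).
Proof. intros Hi. exists 1. split; [lra|]. intros p [(_ & _ & _ & H) _]. rewrite pow_1, Rmult_1_l. apply H, Hi. Qed.

Lemma bigO_remainder_u : O 2 (fun p => remainder p cU).
Proof. exists (2 * A). split; [lra|]. intros p [(_ & _ & H & _) _]. exact H. Qed.

Lemma bigO_coupling : O 0 (fun p => jconst (coupling p)).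
Proof. apply (bigO_bounded_scalar _ 1). intros p [(_ & H & _) _]. exact H. Qed.

Lemma bigO_slope (i : component) : O 0 (fun p => slope (coupling p) (position p) i).
Proof.
  exists A. split; [lra|]. intros p [(_ & H & _) _]. rewrite pow_O, Rmult_1_r. apply base_slope_A, H.
Qed.

Lemma bigO_data (F : R -> jet) : (exists L, jshift_stable F L) -> O 0 (fun p => F (position p)).
Proof.
  intros [L HF]. exists L. split; [exact (jshift_stable_ge0 HF)|]. intros p _. rewrite pow_O, Rmult_1_r. apply HF.
Qed.

Lemma bigO_base (i : component) : i <> cV -> O 0 (fun p => base (position p) i).
Proof.
  intros Hi. destruct i; try congruence; [apply bigO_const| | | |];
    first [exact (bigO_data _ jpsi1_stable)|exact (bigO_data _ jpsi2_stable)].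
Qed.

Lemma leading_state (i : component) : i <> cV -> leads (fun p => state p i) (fun p => base (position p) i).
Proof.
  intros Hi. split; [exact (bigO_base i Hi)|].
  apply (bigO_ext (fun p => remainder p i + jconst (time p) * slope (coupling p) (position p) i)%J);
    [intros p _; unfold remainder; ring|].
  apply bigO_add; [|apply bigO_scale_mul, bigO_slope].
  destruct i; try congruence; try (apply bigO_remainder; reflexivity).
  apply (bigO_weaken 2); [lia|exact bigO_remainder_u].
Qed.

Lemma leading_jdc : leads (fun p => jdc (state p)) (fun _ => jconst (Dc 1%nat phi1)).
Proof.
  apply leading_comp; [exact Dc_derivatives|intros; apply Dc_bounded; lia|].
  apply (leading_state cU). discriminate.
Qed.

Lemma leading_ja : leads (fun p => ja (state p)) (fun _ => jconst (Da 0%nat phi1)).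
Proof.
  apply leading_comp; [exact Da_derivatives|intros; apply Da_bounded; lia|].
  apply (leading_state cU). discriminate.
Qed.

Lemma leading_jda : leads (fun p => jda (state p)) (fun _ => jconst (Da 1%nat phi1)).
Proof.
  apply leading_comp; [exact Da_derivatives|intros; apply Da_bounded; lia|].
  apply (leading_state cU). discriminate.
Qed.

Lemma leading_ja_inv : leads (fun p => / ja (state p))%J (fun _ => jconst (/ Da 0%nat phi1)).
Proof.
  apply (leading_inv m0_pos); [apply Rge_le, a_lower| |exact leading_ja].
  intros p _. apply Rge_le, a_lower.
Qed.

Lemma bigO_jc : O 1 (fun p => jc (state p)).
Proof.
  assert (H : leads (fun p => jc (state p)) (fun _ => jconst (Dc 0%nat phi1))).
  { apply leading_comp; [exact Dc_derivatives|intros; apply Dc_bounded; lia|].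
    apply (leading_state cU). discriminate. }
  rewrite c_phi1 in H. revert H. intros [_ H]. revert H. apply bigO_ext. intros p _. ring.
Qed.

Lemma c_lower (p : point) : admissible p -> m0 * psi0 / 2 * time p <= Rabs (jval (jc (state p))).
Proof.
  intros ([Ht0 Ht1] & _ & Hu & _). set (t := time p) in *. set (z := jval (state p cU)).
  assert (Hz : psi0 / 2 * t <= Rabs (z - phi1)).
  { set (e := z - (phi1 + t * Dpsi1 0%nat (position p))).
    assert (He : Rabs e <= 2 * A * t ^ 2) by exact (Rle_trans _ _ _ (Rabs_jval_le _) Hu).
    pose proof (Rabs_triang_inv (t * Dpsi1 0%nat (position p)) (- e)) as Htriang. rewrite Rabs_Ropp in Htriang.
    replace (t * Dpsi1 0%nat (position p) - - e) with (z - phi1) in Htriang by (unfold e; ring).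
    rewrite Rabs_mult, (Rabs_pos_eq t) in Htriang by lra.
    pose proof (Rmult_le_compat_l t _ _ (Rlt_le _ _ Ht0) (Rge_le _ _ (psi1_lower (position p)))).
    assert (2 * A * t ^ 2 <= psi0 / 2 * t).
    { replace (2 * A * t ^ 2) with (2 * A * t * t) by ring. apply Rmult_le_compat_r; [lra|].
      eapply Rle_trans; [|exact delta0_small]. apply Rmult_le_compat_l; lra. }
    lra. }
  destruct (MVT_abs (Dc 0%nat) (Dc 1%nat) phi1 z) as [y [Hy _]]; [intros; apply Dc_derivatives|].
  rewrite c_phi1, Rminus_0_r in Hy. change (jval (jc (state p))) with (Dc 0%nat z). rewrite Hy.
  replace (m0 * psi0 / 2 * t) with (m0 * (psi0 / 2 * t)) by field.
  apply Rmult_le_compat; [lra| |apply Rge_le, dc_lower|exact Hz]. apply Rmult_le_pos; lra.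
Qed.

Lemma c_lower_pos : 0 < m0 * psi0 / 2.
Proof. apply Rdiv_lt_0_compat; [apply Rmult_lt_0_compat; assumption|lra]. Qed.

Lemma admissible_c_nonzero (p : point) : admissible p -> c_nonzero (fun i => jval (state p i)).
Proof.
  intros Hp E. pose proof (c_lower p Hp) as H. simpl in H. rewrite E, Rabs_R0 in H.
  pose proof (Rmult_lt_0_compat _ (time p) c_lower_pos (proj1 (proj1 Hp))). lra.
Qed.

Definition time_over_c (p : point) : jet := (jconst (time p) * / jc (state p))%J.

Lemma bigO_time_over_c : O 0 time_over_c.
Proof.
  apply (bigO_ext (fun p => jconst (time p ^ 1) * / jc (state p))%J); [intros; rewrite pow_1; reflexivity|].
  apply (bigO_inv 1 c_lower_pos); [|exact bigO_jc].
  intros p [Hp _]. rewrite pow_1. apply c_lower, Hp.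
Qed.

Lemma jtime_inv (p : point) : small admissible time p -> (jconst (time p) * jconst (/ time p) = 1)%J.
Proof. intros [_ Hp]. rewrite <- jconst_mul, Rinv_r by lra. reflexivity. Qed.

Lemma over_c_expansion (p : point) (k q : jet) : small admissible time p ->
  ((jconst (time p) * k + q) * / jc (state p) =
    k * time_over_c p + time_over_c p * (jconst (/ time p) * q))%J.
Proof.
  intros Hp. pose proof (jtime_inv p Hp) as Ht. unfold time_over_c.
  transitivity ((jconst (time p) * k + (jconst (time p) * jconst (/ time p)) * q) * / jc (state p))%J;
    [rewrite Ht|]; ring.
Qed.

(* Since [c(u) = c'(u) (u - phi1) + O(t^2)] and [u - phi1 = psi1 t + O(t^2)]. *)
Lemma leading_singular_coefficient (r : point -> jet) : leads r (fun p => jpsi1 (position p)) ->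
  leads (fun p => jdc (state p) * r p * time_over_c p)%J (fun _ => 1%J).
Proof.
  intros [_ Hr]. split; [apply bigO_const|].
  set (u := fun p => (state p cU - jconst phi1)%J).
  assert (Htaylor : O 2 (fun p => jc (state p) - jdc (state p) * u p)%J).
  { apply (bigO_ext (fun p => jc (state p) - jconst (Dc 0%nat phi1) - jdc (state p) * u p)%J);
      [intros; rewrite c_phi1; ring|].
    apply (bigO_comp_taylor (n := 0)); [exact Dc_derivatives|intros; apply Dc_bounded; lia|].
    apply (leading_state cU). discriminate. }
  assert (Hnum : O 2 (fun p => jdc (state p) * (jconst (time p) * r p) - jc (state p))%J).
  { apply (bigO_ext (fun p => jdc (state p) * (jconst (time p) * (r p - jpsi1 (position p)) - remainder p cU)
      - (jc (state p) - jdc (state p) * u p))%J); [intros; unfold u, remainder; simpl base; simpl slope; ring|].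
    apply bigO_sub; [|exact Htaylor]. apply bigO_mul_bounded; [exact (leading_bounded leading_jdc)|].
    apply bigO_sub; [apply bigO_scale_mul, Hr|exact bigO_remainder_u]. }
  apply (bigO_ext (fun p => time_over_c p *
    (jconst (/ time p) * (jdc (state p) * (jconst (time p) * r p) - jc (state p))))%J).
  - intros p Hp. unfold time_over_c.
    pose proof (jmul_inv (jc (state p)) (admissible_c_nonzero p (proj1 Hp))) as Hc. pose proof (jtime_inv p Hp) as Ht.
    transitivity ((jconst (time p) * jconst (/ time p)) * (jdc (state p) * r p * (jconst (time p) * / jc (state p))
      - jc (state p) * / jc (state p)))%J; [ring|]. rewrite Ht, Hc. ring.
  - apply bigO_mul_bounded; [exact bigO_time_over_c|]. apply bigO_scale_div, Hnum.
Qed.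

Definition skew_remainder1 (p : point) : jet := half (remainder p cR1 - remainder p cS1).
Definition skew_remainder2 (p : point) : jet := half (remainder p cR2 - remainder p cS2).

Lemma half_difference1 (p : point) :
  half (state p cR1 - state p cS1) = (jconst (time p) * 0 + skew_remainder1 p)%J.
Proof. unfold skew_remainder1, remainder, half. simpl base; simpl slope. ring. Qed.

Lemma half_difference2 (p : point) :
  half (state p cR2 - state p cS2) = (jconst (time p) * slope2_odd (position p) + skew_remainder2 p)%J.
Proof.
  unfold skew_remainder2, remainder. simpl base; simpl slope.
  rewrite <- (half_double (jconst (time p) * slope2_odd (position p))). unfold half. ring.
Qed.

Lemma bigO_skew_remainder2 : O 1 skew_remainder2.
Proof.
  apply (bigO_mul_bounded (f := fun _ => jconst (/ 2))); [apply bigO_const|].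
  apply bigO_sub; apply bigO_remainder; reflexivity.
Qed.

Lemma bigO_slope2_odd : O 0 (fun p => slope2_odd (position p)).
Proof.
  apply bigO_mul_bounded; [apply bigO_const|].
  apply bigO_mul_bounded; [exact (bigO_data _ jpsi1_stable)|exact (bigO_data _ jdphi2_stable)].
Qed.

(* [(R2 - S2) / (2 c)] is [v_x], hence tends to [phi2']. *)
Lemma leading_slope2_odd_over_c :
  leads (fun p => slope2_odd (position p) * time_over_c p)%J (fun p => jdphi2 (position p)).
Proof.
  assert (Hpsi1 := leading_refl (bigO_data _ jpsi1_stable)).
  assert (Hdphi2 := leading_refl (bigO_data _ jdphi2_stable)).
  assert (Hcoef := leading_mul (leading_singular_coefficient _ Hpsi1) Hdphi2).
  assert (Herr : O 1 (fun p => - ((jdc (state p) - jconst (Dc 1%nat phi1)) *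
      (jpsi1 (position p) * jdphi2 (position p) * time_over_c p)))%J).
  { apply bigO_opp, (bigO_mul 1 0); [apply leading_jdc|].
    apply bigO_mul_bounded; [apply bigO_mul_bounded; [apply Hpsi1|apply Hdphi2]|exact bigO_time_over_c]. }
  refine (leading_ext _ _ (leading_add_small Hcoef Herr)); intros p _.
  - unfold slope2_odd. ring.
  - ring.
Qed.

Lemma bigO_half_difference2 : O 1 (fun p => half (state p cR2 - state p cS2)).
Proof.
  apply (bigO_ext (fun p => jconst (time p) * slope2_odd (position p) + skew_remainder2 p)%J);
    [intros; symmetry; apply half_difference2|].
  apply bigO_add; [apply bigO_scale_mul, bigO_slope2_odd|exact bigO_skew_remainder2].
Qed.

Lemma bigO_half_difference2_over_c : O 0 (fun p => half (state p cR2 - state p cS2) * / jc (state p))%J.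
Proof.
  apply (bigO_ext (fun p => slope2_odd (position p) * time_over_c p
    + time_over_c p * (jconst (/ time p) * skew_remainder2 p))%J).
  - intros p Hp. rewrite half_difference2. symmetry. apply over_c_expansion, Hp.
  - apply bigO_add; apply bigO_mul_bounded; try exact bigO_time_over_c; [exact bigO_slope2_odd|].
    apply bigO_scale_div, bigO_skew_remainder2.
Qed.

Definition unit_singular (f q L : point -> jet) : Prop :=
  exists E N, O 1 E /\ leads N L /\
    forall p, small admissible time p -> f p = ((1 + E p) * (jconst (/ time p) * q p) + N p)%J.

Definition weakly_singular (f q L : point -> jet) : Prop :=
  exists B N, O 0 B /\ leads N L /\
    forall p, small admissible time p -> f p = (jconst (coupling p) * B p * (jconst (/ time p) * q p) + N p)%J.

Lemma unit_singular_opp {f q L : point -> jet} :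
  unit_singular f q L -> unit_singular (fun p => - f p)%J (fun p => - q p)%J (fun p => - L p)%J.
Proof.
  intros (E & N & HE & HN & Hf). exists E, (fun p => - N p)%J.
  split; [exact HE|]. split; [apply leading_opp, HN|]. intros p Hp. rewrite Hf by exact Hp. ring.
Qed.

Lemma unit_singular_skew_source (r d k q : point -> jet) :
  leads r (fun p => jpsi1 (position p)) -> O 0 k ->
  (forall p, half (d p) = (jconst (time p) * k p + q p)%J) ->
  unit_singular (fun p => skew_source (r p) (d p) (state p)) q k.
Proof.
  intros Hr Hk Hd. pose proof (leading_singular_coefficient r Hr) as Hcoef.
  set (coef := fun p => (jdc (state p) * r p * time_over_c p)%J) in *.
  exists (fun p => coef p - 1)%J, (fun p => coef p * k p)%J. split; [apply Hcoef|]. split.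
  - refine (leading_ext (fun _ _ => eq_refl) _ (leading_mul Hcoef (leading_refl Hk))).
    intros. ring.
  - intros p Hp. unfold skew_source, coef. rewrite Hd, over_c_expansion by exact Hp. ring.
Qed.

Lemma weakly_singular_common_source1 :
  weakly_singular (fun p => common_source1 (coupling p) (state p)) skew_remainder2
    (fun p => slope1 (coupling p) (position p)).
Proof.
  set (a_da := fun p => (ja (state p) * jda (state p))%J). set (d := fun p => half (state p cR2 - state p cS2)).
  assert (Ha_da := leading_mul leading_ja leading_jda : leads a_da _).
  assert (Hprod := leading_mul (leading_state cR2 ltac:(discriminate)) (leading_state cS2 ltac:(discriminate))).
  exists (fun p => jconst 2 * a_da p * time_over_c p)%J.
  exists (fun p => (a_da p * (state p cR2 * state p cS2)
    + jconst (coupling p) * (jconst 2 * a_da p * (slope2_odd (position p) * time_over_c p)))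
    + - (ja (state p) * ja (state p) * jdc (state p) * (d p * (d p * / jc (state p)))))%J.
  split; [|split].
  - apply bigO_mul_bounded; [|exact bigO_time_over_c].
    apply bigO_mul_bounded; [apply bigO_const|exact (leading_bounded Ha_da)].
  - apply leading_add_small.
    + refine (leading_ext (fun _ _ => eq_refl) _ (leading_add (leading_mul Ha_da Hprod)
        (leading_mul (leading_refl bigO_coupling)
          (leading_mul (leading_mul (leading_const 2) Ha_da) leading_slope2_odd_over_c)))).
      intros p _. unfold slope1. rewrite !jconst_mul. simpl base. ring.
    + apply bigO_opp, bigO_mul_bounded.
      * pose proof (leading_bounded leading_ja) as Ha.
        apply bigO_mul_bounded; [apply bigO_mul_bounded; exact Ha|exact (leading_bounded leading_jdc)].
      * apply (bigO_mul 1 0); [exact bigO_half_difference2|exact bigO_half_difference2_over_c].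
  - intros p Hp. unfold common_source1, a_da, d.
    rewrite half_difference2, over_c_expansion by exact Hp. ring.
Qed.

Lemma weakly_singular_common_source2 :
  weakly_singular (fun p => common_source2 (coupling p) (state p)) skew_remainder1
    (fun p => - slope2_even (position p))%J.
Proof.
  exists (fun p => - (jconst 2 * (jda (state p) * / ja (state p)) * time_over_c p))%J.
  exists (fun p => - (jda (state p) * / ja (state p) * (state p cR1 * state p cS2 + state p cS1 * state p cR2)))%J.
  pose proof (leading_mul leading_jda leading_ja_inv) as Hda. split; [|split].
  - apply bigO_opp, bigO_mul_bounded; [|exact bigO_time_over_c].
    apply bigO_mul_bounded; [apply bigO_const|exact (leading_bounded Hda)].
  - refine (leading_ext (fun _ _ => eq_refl) _ (leading_opp (leading_mul Hda
      (leading_add (leading_mul (leading_state cR1 ltac:(discriminate)) (leading_state cS2 ltac:(discriminate)))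
        (leading_mul (leading_state cS1 ltac:(discriminate)) (leading_state cR2 ltac:(discriminate))))))).
    intros p _. unfold slope2_even. simpl base. apply jet_ext; simpl; ring.
  - intros p Hp. unfold common_source2. rewrite half_difference1, over_c_expansion by exact Hp. ring.
Qed.

Lemma singular_sum_estimate {f g q r L L' : point -> jet} : unit_singular f q L -> weakly_singular g r L' ->
  exists K, forall p m, small admissible time p -> jnorm (q p) <= m -> jnorm (r p) <= m ->
    jnorm (f p + g p - (L p + L' p)) <= (1 + K * (time p + Rabs (coupling p))) * (m / time p) + K * time p.
Proof.
  intros (E & N & (KE & HE0 & HE) & [_ (KN & HN0 & HN)] & Hf).
  intros (B & N' & (KB & HB0 & HB) & [_ (KN' & HN0' & HN')] & Hg).
  exists (KE + KB + KN + KN'). intros p m Hp Hq Hr.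
  specialize (HE p Hp). specialize (HN p Hp). specialize (HB p Hp). specialize (HN' p Hp).
  rewrite pow_1 in HE, HN, HN'. rewrite pow_O, Rmult_1_r in HB.
  rewrite Hf, Hg by exact Hp. destruct Hp as [_ [Ht _]]. set (t := time p) in *. set (l := Rabs (coupling p)).
  assert (Hi : 0 < / t) by (apply Rinv_0_lt_compat, Ht).
  assert (Hm : 0 <= m / t).
  { apply Rmult_le_pos; [exact (Rle_trans _ _ _ (jnorm_ge0 _) Hq)|lra]. }
  assert (Hl : 0 <= l) by apply Rabs_pos.
  assert (Hresidue : forall j, jnorm j <= m -> jnorm (jconst (/ t) * j) <= m / t).
  { intros j Hj. unfold Rdiv. rewrite Rmult_comm. apply jnorm_scale_le; [lra|exact Hj]. }
  replace (_ - _)%J with ((1 + E p) * (jconst (/ t) * q p) + jconst (coupling p) * B p * (jconst (/ t) * r p)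
    + ((N p - L p) + (N' p - L' p)))%J by ring.
  apply Rle_trans with ((1 + KE * t) * (m / t) + l * KB * (m / t) + (KN * t + KN' * t)).
  - apply jnorm_add_le; [|apply jnorm_add_le; assumption].
    apply jnorm_add_le; (apply jnorm_mul_le; [|apply Hresidue; assumption]).
    + apply jnorm_add_le; [rewrite jnorm_const, Rabs_R1; lra|exact HE].
    + rewrite jnorm_scale. apply Rmult_le_compat_l; [exact Hl|exact HB].
  - assert (Hpos : forall a b, 0 <= a -> 0 <= b -> 0 <= a * b * (m / t)).
    { intros a b Ha Hb. apply Rmult_le_pos; [apply Rmult_le_pos|]; assumption. }
    pose proof (Hpos KE l HE0 Hl). pose proof (Hpos KB t HB0 (Rlt_le _ _ Ht)).
    pose proof (Hpos KN t HN0 (Rlt_le _ _ Ht)).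
    pose proof (Hpos KN l HN0 Hl). pose proof (Hpos KN' t HN0' (Rlt_le _ _ Ht)). pose proof (Hpos KN' l HN0' Hl).
    pose proof (Rmult_le_pos KE t HE0 (Rlt_le _ _ Ht)). pose proof (Rmult_le_pos KB t HB0 (Rlt_le _ _ Ht)). lra.
Qed.

Definition source_bound (K : R) (i : component) : Prop := forall p m, admissible p ->
  (forall j, riemann j = true -> jnorm (remainder p j) <= m) ->
  jnorm (source (coupling p) i (state p) - slope (coupling p) (position p) i)
    <= (1 + K * (time p + Rabs (coupling p))) * (m / time p) + K * time p.

Definition controlled (q : point -> jet) : Prop :=
  forall p m, (forall j, riemann j = true -> jnorm (remainder p j) <= m) -> jnorm (q p) <= m.

Lemma controlled_skew_remainder1 : controlled skew_remainder1.
Proof.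
  intros p m H. unfold skew_remainder1. rewrite jnorm_half.
  pose proof (jnorm_sub_le _ _ _ _ (H cR1 eq_refl) (H cS1 eq_refl)). lra.
Qed.

Lemma controlled_skew_remainder2 : controlled skew_remainder2.
Proof.
  intros p m H. unfold skew_remainder2. rewrite jnorm_half.
  pose proof (jnorm_sub_le _ _ _ _ (H cR2 eq_refl) (H cS2 eq_refl)). lra.
Qed.

Lemma controlled_opp {q : point -> jet} : controlled q -> controlled (fun p => - q p)%J.
Proof. intros Hq p m H. rewrite jnorm_opp. apply Hq, H. Qed.

Lemma source_bound_of_singular_sum {i : component} {f g q r L L' : point -> jet} :
  unit_singular f q L -> weakly_singular g r L' -> controlled q -> controlled r ->
  (forall p, source (coupling p) i (state p) = (f p + g p)%J) ->
  (forall p, slope (coupling p) (position p) i = (L p + L' p)%J) ->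
  exists K, source_bound K i.
Proof.
  intros Hf Hg Hq Hr Hsource Hslope. destruct (singular_sum_estimate Hf Hg) as [K H].
  exists K. intros p m Hp Hrem. rewrite Hsource, Hslope.
  apply H; [exact (admissible_small p Hp)|apply Hq, Hrem|apply Hr, Hrem].
Qed.

Lemma unit_singular_skew_source1 : unit_singular
  (fun p => skew_source (half (state p cR1 + state p cS1)) (state p cR1 - state p cS1) (state p))
  skew_remainder1 (fun _ => 0%J).
Proof.
  apply unit_singular_skew_source; [|apply bigO_const|exact half_difference1].
  refine (leading_ext (fun _ _ => eq_refl) _ (leading_mul (leading_const (/ 2))
    (leading_add (leading_state cR1 ltac:(discriminate)) (leading_state cS1 ltac:(discriminate))))).
  intros p _. rewrite <- (half_double (jpsi1 (position p))). simpl base. unfold half. ring.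
Qed.

Lemma unit_singular_skew_source2 (j : component) : j = cR1 \/ j = cS1 -> unit_singular
  (fun p => skew_source (state p j) (state p cR2 - state p cS2) (state p))
  skew_remainder2 (fun p => slope2_odd (position p)).
Proof.
  intros Hj. apply unit_singular_skew_source; [|exact bigO_slope2_odd|exact half_difference2].
  destruct Hj as [-> | ->]; [apply (leading_state cR1)|apply (leading_state cS1)]; discriminate.
Qed.

Lemma riemann_source_bound (i : component) : riemann i = true -> exists K, source_bound K i.
Proof.
  pose proof controlled_skew_remainder1 as Hskew1. pose proof controlled_skew_remainder2 as Hskew2.
  intros Hi. destruct i; try discriminate.
  - apply (source_bound_of_singular_sum unit_singular_skew_source1 weakly_singular_common_source1 Hskew1 Hskew2);
      intros p; simpl; ring.
  - apply (source_bound_of_singular_sum (unit_singular_opp unit_singular_skew_source1)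
      weakly_singular_common_source1 (controlled_opp Hskew1) Hskew2); intros p; simpl; ring.
  - apply (source_bound_of_singular_sum (unit_singular_skew_source2 cR1 (or_introl eq_refl))
      weakly_singular_common_source2 Hskew2 Hskew1); intros p; simpl; ring.
  - apply (source_bound_of_singular_sum
      (unit_singular_opp (unit_singular_skew_source2 cS1 (or_intror eq_refl)))
      weakly_singular_common_source2 (controlled_opp Hskew2) Hskew1); intros p; simpl; ring.
Qed.

Lemma source_bound_weaken {K K' : R} {i : component} : K <= K' -> source_bound K i -> source_bound K' i.
Proof.
  intros HK H p m Hp Hrem. eapply Rle_trans; [apply (H p m Hp Hrem)|].
  pose proof (proj1 (proj1 Hp)) as Ht. pose proof (Rabs_pos (coupling p)).
  assert (0 <= m / time p).
  { apply Rdiv_le_0_compat; [|exact Ht]. exact (Rle_trans _ _ _ (jnorm_ge0 _) (Hrem cR1 eq_refl)). }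
  apply Rplus_le_compat; apply Rmult_le_compat_r; try lra. apply Rplus_le_compat_l, Rmult_le_compat_r; lra.
Qed.

Lemma common_source_speed_bound : exists K, 0 <= K /\
  (forall p, admissible p -> jnorm (jc (state p)) <= K * time p) /\
  forall i, riemann i = true -> source_bound K i.
Proof.
  destruct bigO_jc as (C & HC0 & HC).
  destruct (component_common_bound (fun i K => riemann i = true -> source_bound K i) C) as (K & HCK & HK).
  - intros i x y Hxy H Hi. exact (source_bound_weaken Hxy (H Hi)).
  - intros i. destruct (riemann i) eqn:Hi; [|exists 0; discriminate].
    destruct (riemann_source_bound i Hi) as [K HK]. exists K. intros _. exact HK.
  - exists K. split; [lra|]. split; [|exact HK]. intros p Hp.
    eapply Rle_trans; [apply HC, admissible_small, Hp|]. rewrite pow_1. apply Rmult_le_compat_r; [|exact HCK].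
    left. apply Hp.
Qed.

Section LocalSolution.
Variables delta lam K : R.
Hypothesis K_ge0 : 0 <= K.
Hypothesis speed_bound_K : forall p, admissible p -> jnorm (jc (state p)) <= K * time p.
Hypothesis source_bound_K : forall i, riemann i = true -> source_bound K i.

Let M : R := 4 * (2 * A * K + K).
Hypothesis delta_range : 0 < delta <= delta0.
Hypothesis M_delta : M * delta <= 1.
Hypothesis K_delta : 16 * K * delta <= 1.
Hypothesis lam_delta : Rabs lam <= delta.

Definition remainder_cst (i : component) : R := if riemann i then M else 2 * A.
Definition speed_cst (i : component) : R := if riemann i then K else 0.
Definition source_cst (i : component) : R := if riemann i then 5 / 4 * M + K else 2 * A.

Let near_data : R -> R -> (component -> jet) -> Prop := near component base (slope lam) remainder_cst.

Lemma M_nonneg : 0 <= 2 * A * K /\ 0 <= M.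
Proof. assert (0 <= A * K) by (apply Rmult_le_pos; lra). unfold M. lra. Qed.

Lemma M_quadratic_le (t : R) : 0 < t <= delta -> M * t ^ 2 <= t.
Proof.
  intros Ht. pose proof M_nonneg. replace (M * t ^ 2) with (M * t * t) by ring. rewrite <- (Rmult_1_l t) at 3.
  apply Rmult_le_compat_r; [lra|]. apply Rle_trans with (M * delta); [apply Rmult_le_compat_l; lra|exact M_delta].
Qed.

Lemma near_remainder (t x : R) (w : component -> jet) (i : component) : near_data t x w ->
  jnorm (remainder (Point t lam x w) i) <= remainder_cst i * t ^ 2.
Proof. intros Hw. exact (Hw i). Qed.

Lemma near_riemann_remainder (t x : R) (w : component -> jet) (i : component) : near_data t x w ->
  riemann i = true -> jnorm (remainder (Point t lam x w) i) <= M * t ^ 2.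
Proof.
  intros Hw Hi. pose proof (near_remainder t x w i Hw) as H. unfold remainder_cst in H. rewrite Hi in H. exact H.
Qed.

Lemma near_admissible (t x : R) (w : component -> jet) : 0 < t <= delta -> near_data t x w ->
  admissible (Point t lam x w).
Proof.
  intros Ht Hw. split; [simpl; lra|]. split; [simpl; lra|]. split; [exact (near_remainder t x w cU Hw)|].
  intros i Hi. exact (Rle_trans _ _ _ (near_riemann_remainder t x w i Hw Hi) (M_quadratic_le t Ht)).
Qed.

Lemma near_speed_bound (t x : R) (w : component -> jet) (i : component) : 0 < t <= delta -> near_data t x w ->
  jnorm (speed i w) <= speed_cst i * t.
Proof.
  intros Ht Hw. pose proof (speed_bound_K _ (near_admissible t x w Ht Hw)) as H. simpl in H.
  destruct i; unfold speed_cst; simpl; rewrite ?jnorm_opp, ?jnorm_0; lra.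
Qed.

Lemma half_sum_remainder (a b g p q : jet) (t e : R) : 0 <= t ->
  jnorm (a - (g + jconst t * p)) <= e -> jnorm (b - (g + jconst t * q)) <= e -> jnorm p <= A -> jnorm q <= A ->
  jnorm (half (a + b) - g) <= e + t * A.
Proof.
  intros Ht Ha Hb Hp Hq.
  replace (half (a + b) - g)%J with (half ((a - (g + jconst t * p)) + (b - (g + jconst t * q)) + jconst t * (p + q)))
    by (rewrite <- (half_double g) at 3; unfold half; ring).
  rewrite jnorm_half.
  pose proof (jnorm_add_le _ _ _ _ (jnorm_add_le _ _ _ _ Ha Hb)
    (jnorm_scale_le t (A + A) (p + q) Ht (jnorm_add_le _ _ _ _ Hp Hq))). lra.
Qed.

Lemma near_source_bound (t x : R) (w : component -> jet) (i : component) : 0 < t <= delta -> near_data t x w ->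
  jnorm (source lam i w - slope lam x i) <= source_cst i * t.
Proof.
  intros Ht Hw. assert (Ht0 : 0 <= t) by lra. assert (Hlam : Rabs lam <= 1) by lra.
  assert (HA : forall j, jnorm (slope lam x j) <= A) by (intros j; apply (proj2 (base_slope_A j) lam Hlam)).
  unfold source_cst. destruct (riemann i) eqn:Hi.
  - eapply Rle_trans; [apply (source_bound_K i Hi (Point t lam x w) (M * t ^ 2) (near_admissible t x w Ht Hw))|].
    { intros j Hj. apply near_riemann_remainder; assumption. }
    simpl time; simpl coupling. replace (M * t ^ 2 / t) with (M * t) by (field; lra).
    replace ((5 / 4 * M + K) * t) with (5 / 4 * (M * t) + K * t) by ring. apply Rplus_le_compat_r, Rmult_le_compat_r.
    + apply Rmult_le_pos; [apply M_nonneg|lra].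
    + assert (K * (t + Rabs lam) <= K * (2 * delta)) by (apply Rmult_le_compat_l; lra). lra.
  - assert (HMA : M * t ^ 2 + t * A <= 2 * A * t).
    { pose proof (M_quadratic_le t Ht). pose proof (Rmult_le_compat_r t 1 A Ht0 A_ge1). lra. }
    eapply Rle_trans; [|exact HMA]. destruct i; try discriminate.
    + exact (half_sum_remainder _ _ _ _ _ t _ Ht0 (Hw cR1) (Hw cS1) (HA cR1) (HA cS1)).
    + exact (half_sum_remainder _ _ _ _ _ t _ Ht0 (Hw cR2) (Hw cS2) (HA cR2) (HA cS2)).
Qed.

Lemma wave_remainder_growth (i : component) :
  source_cst i + 2 * A * speed_cst i + 3 * speed_cst i * remainder_cst i * delta ^ 2 <= 2 * remainder_cst i.
Proof.
  pose proof M_nonneg as HM. unfold source_cst, speed_cst, remainder_cst. destruct (riemann i); [|lra].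
  assert (H : M * (3 * K * delta ^ 2) <= M * (1 / 4)).
  { apply Rmult_le_compat_l; [apply HM|]. assert (0 <= K * delta) by (apply Rmult_le_pos; lra).
    replace (3 * K * delta ^ 2) with (3 * (K * delta) * delta) by ring. nra. }
  unfold M in *. lra.
Qed.

Theorem wave_jets_solvable : exists (W : R -> R -> component -> jet) (Wt : component -> R -> R -> R),
  (forall i, C1_strip delta (fun t x => jval (W t x i)) (Wt i) (fun t x => jder1 (W t x i))) /\
  (forall t x, 0 < t <= delta -> c_nonzero (fun i => jval (W t x i)) /\
    forall i, Wt i t x = rate component speed (source lam) i (W t x)) /\
  (forall x i, jval (W 0 x i) = jval (base x i) /\ Wt i 0 x = jval (slope lam x i)).
Proof.
  assert (Hlam : Rabs lam <= 1) by lra. pose proof M_nonneg as HM.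
  assert (Hdomain : forall t x w, 0 < t <= delta -> near_data t x w -> c_nonzero (fun i => jval (w i)))
    by (intros t x w Ht Hw; exact (admissible_c_nonzero _ (near_admissible t x w Ht Hw))).
  destruct (singular_cauchy_problem_solvable component speed (source lam) base (slope lam) c_nonzero delta A
    remainder_cst speed_cst source_cst) as (W & Wt & HC1 & Heq & Hinit).
  - lra.
  - exact base_holonomic.
  - exact (slope_holonomic lam).
  - intros i. apply base_slope_A.
  - intros i. apply base_slope_A, Hlam.
  - exact speed_operator.
  - exact (source_operator lam).
  - exact Hdomain.
  - exact near_speed_bound.
  - exact near_source_bound.
  - intros i. unfold remainder_cst. destruct (riemann i); lra.
  - intros i. unfold speed_cst. destruct (riemann i); lra.
  - intros i. unfold source_cst. destruct (riemann i); lra.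
  - intros i. unfold speed_cst. destruct (riemann i); [|lra].
    assert (0 <= K * delta) by (apply Rmult_le_pos; lra). lra.
  - exact wave_remainder_growth.
  - exists W, Wt. split; [exact HC1|]. split; [|exact Hinit]. intros t x Ht. destruct (Heq t x Ht) as [Hnear Hrate].
    split; [exact (Hdomain t x _ Ht Hnear)|exact Hrate].
Qed.

Lemma classical_solution_of_wave_jets (c a phi2 psi1 psi2 : R -> R) :
  smooth_with c Dc -> smooth_with a Da -> smooth_with phi2 Dphi2 ->
  smooth_with psi1 Dpsi1 -> smooth_with psi2 Dpsi2 ->
  classical_solution c a Dc Da Dphi2 phi1 phi2 psi1 psi2 lam delta.
Proof.
  intros [Ec _] [Ea _] [Ephi2 _] [Epsi1 _] [Epsi2 _].
  destruct wave_jets_solvable as (W & Wt & HC1 & Heq & Hinit).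
  set (val := fun i t x => jval (W t x i)). set (dx := fun i t x => jder1 (W t x i)).
  exists (val cR1), (val cS1), (val cR2), (val cS2), (val cU), (val cV),
    (Wt cR1), (dx cR1), (Wt cS1), (dx cS1), (Wt cR2), (dx cR2), (Wt cS2), (dx cS2),
    (Wt cU), (dx cU), (Wt cV), (dx cV).
  do 6 (split; [apply HC1|]). split.
  - intros t x Ht. destruct (Heq t x Ht) as [Hc Hrate]. cbv zeta. rewrite <- Ec, <- Ea, !Hrate.
    pose proof (a_neq0 (val cU t x)) as Ha. unfold c_nonzero in Hc. unfold rate, val, dx in *; simpl.
    repeat split; field; repeat split; assumption.
  - intros x. unfold val. rewrite !(fun i => proj1 (Hinit x i)), !(fun i => proj2 (Hinit x i)).
    unfold f11, f21, f22. simpl. rewrite <- Epsi1, <- Epsi2, <- Ephi2.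
    pose proof (a_neq0 phi1). repeat split; field; assumption.
Qed.

End LocalSolution.

End Expansions.

Lemma small_time_exists (d C : R) : 0 < d -> 0 <= C -> exists e, 0 < e <= d /\ C * e <= 1.
Proof.
  intros Hd HC. assert (Hi : 0 < / (C + 1)) by (apply Rinv_0_lt_compat; lra).
  exists (Rmin d (/ (C + 1))). split; [split; [apply Rmin_glb_lt; assumption|apply Rmin_l]|].
  apply Rle_trans with ((C + 1) * / (C + 1)); [|right; apply Rinv_r; lra].
  apply Rmult_le_compat; [exact HC|left; apply Rmin_glb_lt; assumption|lra|apply Rmin_r].
Qed.

Theorem wave_system_solvable (c a phi2 psi1 psi2 : R -> R) :
  smooth_with c Dc -> smooth_with a Da -> smooth_with phi2 Dphi2 ->
  smooth_with psi1 Dpsi1 -> smooth_with psi2 Dpsi2 ->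
  exists delta, 0 < delta /\ forall lam, Rabs lam <= delta ->
    classical_solution c a Dc Da Dphi2 phi1 phi2 psi1 psi2 lam delta.
Proof.
  intros Hc Ha Hphi2 Hpsi1 Hpsi2. destruct base_slope_bound as (A & HA1 & HA).
  destruct (small_time_exists 1 (4 * A / psi0)) as (delta0 & Hd0 & Hd0A); [lra|apply Rdiv_le_0_compat; lra|].
  assert (Hsmall : 2 * A * delta0 <= psi0 / 2).
  { replace (2 * A * delta0) with (psi0 / 2 * (4 * A / psi0 * delta0)) by (field; lra).
    rewrite <- (Rmult_1_r (psi0 / 2)) at 2. apply Rmult_le_compat_l; lra. }
  destruct (common_source_speed_bound A delta0 HA1 HA Hd0 Hsmall) as (K & HK & Hspeed & Hsource).
  assert (HAK : 0 <= A * K) by (apply Rmult_le_pos; lra).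
  destruct (small_time_exists delta0 (4 * (2 * A * K + K) + 16 * K)) as (delta & Hd & HdK); [lra|lra|].
  assert (0 <= (4 * (2 * A * K + K)) * delta) by (apply Rmult_le_pos; lra).
  assert (0 <= 16 * K * delta) by (apply Rmult_le_pos; lra).
  exists delta. split; [lra|]. intros lam Hlam.
  apply (classical_solution_of_wave_jets A delta0 HA1 HA Hd0 Hsmall delta lam K); try assumption; lra.
Qed.

End WaveSystem.

Theorem theorem1p1
  (c a phi2 psi1 psi2 : R -> R) (Dc Da Dphi2 Dpsi1 Dpsi2 : nat -> R -> R)
  (m0 psi0 phi1 : R)
  (Hc : smooth_with c Dc) (Ha : smooth_with a Da)
  (Hcb : forall l : nat, (1 <= l <= 3)%nat -> bounded_fun (Dc l))
  (Hab : forall l : nat, (1 <= l <= 3)%nat -> bounded_fun (Da l))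
  (Hm0 : 0 < m0)
  (Hc1 : forall z, Rabs (Dc 1%nat z) >= m0)
  (Ha0 : forall z, Rabs (a z) >= m0)
  (Hphi1 : c phi1 = 0)
  (Hphi2 : smooth_with phi2 Dphi2) (Hpsi1 : smooth_with psi1 Dpsi1)
  (Hpsi2 : smooth_with psi2 Dpsi2)
  (Hphi2b : forall j : nat, (1 <= j <= 4)%nat -> bounded_fun (Dphi2 j))
  (Hpsi1b : forall k : nat, (k <= 3)%nat -> bounded_fun (Dpsi1 k))
  (Hpsi2b : forall k : nat, (k <= 3)%nat -> bounded_fun (Dpsi2 k))
  (Hpsi0 : 0 < psi0)
  (Hpsi1low : forall x, Rabs (psi1 x) >= psi0) :
  exists lambda0 delta : R, 0 < lambda0 /\ 0 < delta /\
    forall lambda : R, Rabs lambda <= lambda0 ->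
      classical_solution c a Dc Da Dphi2 phi1 phi2 psi1 psi2 lambda delta.
Proof.
  pose proof Hc as [Ec Dc_derivatives]. pose proof Ha as [Ea Da_derivatives].
  pose proof Hphi2 as [_ Dphi2_derivatives].
  pose proof Hpsi1 as [Epsi1 Dpsi1_derivatives]. pose proof Hpsi2 as [_ Dpsi2_derivatives].
  assert (a_lower : forall z, Rabs (Da 0%nat z) >= m0) by (intros z; rewrite Ea; apply Ha0).
  assert (psi1_lower : forall x, Rabs (Dpsi1 0%nat x) >= psi0) by (intros x; rewrite Epsi1; apply Hpsi1low).
  assert (c_phi1 : Dc 0%nat phi1 = 0) by (rewrite Ec; exact Hphi1).
  destruct (wave_system_solvable Dc Da Dphi2 Dpsi1 Dpsi2 m0 psi0 phi1) with (c := c) (a := a) (phi2 := phi2)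
    (psi1 := psi1) (psi2 := psi2) as (delta & Hdelta & Hsol); try assumption.
  exists delta, delta. auto.
Qed.
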